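(* Let $d\ge 1$ and $n\ge 2$. Then $F(\mathbb R^d,n)$ contains, as an $\mathfrak S_n$-equivariant strong deformation retract, a finite regular CW complex $X(d,n)$ of dimension $(d-1)(n-1)$ with $n!$ vertices and $n!$ maximal cells (and, when $d\ge 2$, $(n-1)\,n!$ cells of dimension $(d-1)(n-1)-1$), such that: (1) the non-empty cells $\check c(\sigma,\mathbf i)$ of $X(d,n)$ are indexed by the elements $(\sigma,\mathbf i)=(\sigma_1\prec_{i_1}\cdots\prec_{i_{n-1}}\sigma_n)$ of $P'(d,n)$, i.e. $\sigma\in\mathfrak S_n$ and $\mathbf i\in\{1,\dots,d\}^{n-1}$; (2) $\dim\check c(\sigma,\mathbf i)=(i_1+\dots+i_{n-1})-(n-1)$; (3) $\check c(\sigma,\mathbf i)\subseteq \check c(\sigma',\mathbf i')$ iff $(\sigma,\mathbf i)\preceq(\sigma',\mathbf i')$, where $(\sigma,\mathbf i)\preceq(\sigma',\mathbf i')$ means: for all distinct letters $a,b$ with $a$ before $b$ in $\sigma'$, either $a$ is before $b$ in $\sigma$ and $m_{\sigma,\mathbf i}(a,b)\le m_{\sigma',\mathbf i'}(a,b)$, or $b$ is before $a$ in $\sigma$ and $m_{\sigma,\mathbf i}(a,b)<m_{\sigma',\mathbf i'}(a,b)$; (4) the barycentric subdivision of $X(d,n)$ (the order complex $\Delta P'(d,n)$) is geometrically realized in $W_n^{\oplus d}\subset\mathbb R^{d\times n}$ by the simplices $\operatorname{conv}\{v(c_0),\dots,v(c_k)\}$ for chains $c_0\prec\dots\prec c_k$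 in $P'(d,n)$, where for $(\sigma,\mathbf i)\in P'(d,n)$ the point $v(\sigma,\mathbf i)=(x_1,\dots,x_n)$ is given by $\tilde x_{\sigma_1}=0$, $\tilde x_{\sigma_{j+1}}=\tilde x_{\sigma_j}+e_{i_j}$ ($e_i$ the standard unit vectors of $\mathbb R^d$) and $x_j=\tilde x_j-\frac1n(\tilde x_1+\dots+\tilde x_n)$; this realization $\Delta(d,n)$ is contained in $F(\mathbb R^d,n)$ and is an $\mathfrak S_n$-equivariant strong deformation retract of $F(\mathbb R^d,n)$; (5) $\mathfrak S_n$ acts on $P'(d,n)$ by $\pi\cdot(\sigma,\mathbf i)=(\pi\sigma,\mathbf i)$ (where $\pi\sigma=\pi(\sigma_1)\cdots\pi(\sigma_n)$), and correspondingly on the realization by $\pi\cdot v(\sigma,\mathbf i)=v(\pi\sigma,\mathbf i)$, this being the restriction of the column-permutation action.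
   Context: $F(\mathbb R^d,n)$ is the set of real $d\times n$ matrices with pairwise distinct columns, with $\mathfrak S_n$ acting by permuting columns; $W_n^{\oplus d}=\{(x_1,\dots,x_n)\in\mathbb R^{d\times n}:\sum_j x_j=0\}$. A regular CW complex is one whose closed cells are attached by homeomorphisms of their boundaries. For a string $(\sigma,\mathbf i)=(\sigma_1\prec_{i_1}\cdots\prec_{i_{n-1}}\sigma_n)$ with $\sigma\in\mathfrak S_n$ and distinct letters $a,b$ occupying positions $p<q$ in $\sigma$ (in either order), put $m_{\sigma,\mathbf i}(a,b)=\min\{i_p,\dots,i_{q-1}\}$. $P'(d,n)$ is the set of all such strings with $\mathbf i\in\{1,\dots,d\}^{n-1}$, partially ordered by $\preceq$ as in (3). (These cells are dual to the Fox–Neuwirth strata of $W_n^{\oplus d}$ lying in the complement of the subspaces $x_a=x_b$, the stratum of $(x_1,\dots,x_n)$ being determined by sorting columns lexicographically with index $i_j$ the first coordinate in which consecutive columns differ.) *)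

(* Defs.v *)
From Stdlib Require Import Reals.
From mathcomp Require Import all_boot fingroup perm.
Set Implicit Arguments. Unset Strict Implicit. Unset Printing Implicit Defensive.

Local Open Scope R_scope.

(* ---------- points of R^{d x n}: x j = column j in R^d ---------- *)
Definition pt (d n : nat) := 'I_n -> 'I_d -> R.

Definition rsum (T : finType) (f : T -> R) : R := foldr Rplus 0 (map f (enum T)).

(* l^1 distance on R^{d x n} (induces the Euclidean topology) *)
Definition dist d n (x y : pt d n) : R :=
  rsum (fun j : 'I_n => rsum (fun k : 'I_d => Rabs (x j k - y j k))).

Definition distk k (y z : 'I_k -> R) : R := rsum (fun l : 'I_k => Rabs (y l - z l)).

Definition ballk k (y : 'I_k -> R) : Prop := rsum (fun l : 'I_k => y l * y l) <= 1.
Definition spherek k (y : 'I_k -> R) : Prop := rsum (fun l : 'I_k => y l * y l) = 1.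

Definition config_space d n (x : pt d n) : Prop :=
  forall j j' : 'I_n, j <> j' -> x j <> x j'.

Definition act_pt d n (pi : {perm 'I_n}) (x : pt d n) : pt d n :=
  fun j k => x ((pi^-1)%g j) k.

Definition cont_on (A B : Type) (dA : A -> A -> R) (dB : B -> B -> R)
  (S : A -> Prop) (f : A -> B) : Prop :=
  forall x, S x -> forall eps, 0 < eps -> exists delta, 0 < delta /\
    forall y, S y -> dA x y < delta -> dB (f x) (f y) < eps.

Definition equiv_SDR d n (A : pt d n -> Prop) : Prop :=
  (forall x, A x -> config_space x) /\
  exists H : R -> pt d n -> pt d n,
    cont_on (fun p q : R * pt d n => Rabs (p.1 - q.1) + dist p.2 q.2) (@dist d n)
            (fun p => 0 <= p.1 <= 1 /\ config_space p.2) (fun p => H p.1 p.2) /\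
    (forall t x, 0 <= t <= 1 -> config_space x -> config_space (H t x)) /\
    (forall x, config_space x -> H 0 x = x) /\
    (forall x, config_space x -> A (H 1 x)) /\
    (forall t x, 0 <= t <= 1 -> A x -> H t x = x) /\
    (forall t x (pi : {perm 'I_n}), 0 <= t <= 1 -> config_space x ->
        H t (act_pt pi x) = act_pt pi (H t x)).

(* ---------- the poset P'(d,n) ----------
   An element (sigma, i): sigma : {perm 'I_n}, the letter at (0-based) position p
   is sigma p; i : 'I_(n-1) -> 'I_d, where the paper's index i_{j+1} in {1..d}
   is stored 0-based as (i j : nat) = i_{j+1} - 1. *)
Definition P' (d n : nat) : finType := ({perm 'I_n} * {ffun 'I_n.-1 -> 'I_d})%type.

Definition pos n (s : {perm 'I_n}) (a : 'I_n) : nat := nat_of_ord ((s^-1)%g a).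

Definition before d n (c : P' d n) (a b : 'I_n) : bool := (pos c.1 a < pos c.1 b)%N.

(* m_{sigma,i}(a,b) (0-based, i.e. paper's value minus 1) *)
Definition mval d n (c : P' d n) (a b : 'I_n) : nat :=
  let p := minn (pos c.1 a) (pos c.1 b) in
  let q := maxn (pos c.1 a) (pos c.1 b) in
  \big[minn/d]_(j : 'I_n.-1 | (p <= j)%N && (j < q)%N) nat_of_ord (c.2 j).

Definition preceq d n (c c' : P' d n) : bool :=
  [forall a : 'I_n, forall b : 'I_n, ((a != b) && before c' a b) ==>
     ((before c a b && (mval c a b <= mval c' a b)%N) ||
      (before c b a && (mval c a b < mval c' a b)%N))].

Definition prec d n (c c' : P' d n) : bool := preceq c c' && (c != c').

(* dim of the cell: (i_1+...+i_{n-1}) - (n-1) in the paper's 1-based indexing *)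
Definition dimP d n (c : P' d n) : nat := (\sum_(j : 'I_n.-1) nat_of_ord (c.2 j))%N.

(* action pi.(sigma,i) = (pi sigma, i);  ((c.1 * pi) p = pi (c.1 p)) *)
Definition act_P d n (pi : {perm 'I_n}) (c : P' d n) : P' d n := ((c.1 * pi)%g, c.2).

Definition vtilde d n (c : P' d n) : pt d n :=
  fun a k => INR #|[pred j : 'I_n.-1 | (j < pos c.1 a)%N && (c.2 j == k)]|.
Definition vpt d n (c : P' d n) : pt d n :=
  fun a k => vtilde c a k - / INR n * rsum (fun b : 'I_n => vtilde c b k).

Definition bary d n (ws : seq R) (vs : seq (pt d n)) : pt d n :=
  fun j k => foldr Rplus 0 (map (fun wv => wv.1 * wv.2 j k) (zip ws vs)).

Definition conv d n (vs : seq (pt d n)) (x : pt d n) : Prop :=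
  exists ws : seq R, size ws = size vs /\ List.Forall (fun w => 0 <= w) ws /\
    foldr Rplus 0 ws = 1 /\ x = bary ws vs.

Definition chain d n (s : seq (P' d n)) : bool := sorted (@prec d n) s && (s != [::]).

Definition realize d n (P : pred (P' d n)) (x : pt d n) : Prop :=
  exists s, chain s /\ all P s /\ conv (map (@vpt d n) s) x.

Definition Delta_dn d n : pt d n -> Prop := realize (@predT (P' d n)).
Definition cell d n (c : P' d n) : pt d n -> Prop := realize (fun c' => preceq c' c).
Definition bdry d n (c : P' d n) : pt d n -> Prop := realize (fun c' => prec c' c).

(* the simplices form a geometric simplicial complex: every point is in the
   relative interior of a unique simplex with unique barycentric coordinates *)
Definition geometric_realization d n : Prop :=
  forall s1 s2 (ws1 ws2 : seq R), chain s1 -> chain s2 ->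
    size ws1 = size s1 -> size ws2 = size s2 ->
    List.Forall (fun w => 0 < w) ws1 -> List.Forall (fun w => 0 < w) ws2 ->
    foldr Rplus 0 ws1 = 1 -> foldr Rplus 0 ws2 = 1 ->
    bary ws1 (map (@vpt d n) s1) = bary ws2 (map (@vpt d n) s2) ->
    s1 = s2 /\ ws1 = ws2.

Definition regular_CW d n : Prop :=
  (forall c : P' d n, exists h : ('I_(dimP c) -> R) -> pt d n,
     exists g : pt d n -> ('I_(dimP c) -> R),
       cont_on (@distk (dimP c)) (@dist d n) (@ballk (dimP c)) h /\
       cont_on (@dist d n) (@distk (dimP c)) (cell c) g /\
       (forall y, ballk y -> cell c (h y) /\ g (h y) = y) /\
       (forall x, cell c x -> ballk (g x) /\ h (g x) = x) /\
       (forall y, ballk y -> (spherek y <-> bdry c (h y)))) /\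
  (forall x, Delta_dn x <-> exists c : P' d n, cell c x) /\
  (forall x, Delta_dn x -> exists c : P' d n, cell c x /\ ~ bdry c x) /\
  (forall x (c c' : P' d n), cell c x -> ~ bdry c x -> cell c' x -> ~ bdry c' x -> c = c').

(* Main.v *)
From Stdlib Require Import Reals Lra ClassicalEpsilon FunctionalExtensionality.
From HB Require Import structures.
From mathcomp Require Import all_boot fingroup perm zify.
Require Import Defs.

(**
A string c stands for a Fox-Neuwirth stratum, a relatively open convex cone, and
vpt c is a point of it. Subtracting from a point x of the stratum c the largest
multiple of vpt c that keeps it in the closed stratum lands in a strictly larger
string; iterating, x becomes in a unique way a positive combination of the vpt's of
a chain. As the cones spanned by chains are closed and finite in number, the
coefficients are continuous in x.

All of this is done relatively to a string T: only the local position of x with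
respect to the stratum T counts, that is, x is taken modulo the span [flat T] of that
stratum, and the chains consist of strings strictly below T. Two choices of T give the
theorem. For T = c, the complement of the span has dimension dimP c, and the sum of
the coefficients is a gauge on it whose unit ball is the linear image of the cell c; the
radial rescaling by this gauge maps it to the Euclidean ball. With one more coordinate,
T can be chosen below which all strata lie, those with collisions included; then moving
x linearly to the normalised part of its combination that is supported on
collision-free strings is the deformation retraction.
*)
Set Implicit Arguments. Unset Strict Implicit. Unset Printing Implicit Defensive.

Local Open Scope R_scope.

(** The order on strings reverses the usual closure order: the closed stratum [c] is the union of
    the strata [e] with [preceq c e]. So a chain starts at the stratum of the point and runs upwards
    to more degenerate strata, and its collision-free strings form an initial segment. On the
    configuration space this segment is never empty, which makes the normalisation in the
    deformation possible. Two properties of [vpt c] carry the greedy step: its columns [a] and [b]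
    agree below the level [mval c a b], and differ by at least 1 at that level. The first keeps the
    subtraction inside the span of the stratum; the second makes the largest multiple a minimum of
    finitely many ratios, hence an explicit continuous function as long as the chain is fixed. Two
    obstacles shape the rest. The chain jumps from point to point, so continuity has to be compared
    chain by chain. And the auxiliary string [top] orders the letters by index, hence is not
    invariant under permutations: coefficients at strings with collisions need not be equivariant,
    but the deformation uses only the others. *)

Fact Rplus_associative : associative Rplus.
Proof. by move=> x y z; rewrite Rplus_assoc. Qed.

HB.instance Definition _ :=
  Monoid.isComLaw.Build R 0 Rplus Rplus_associative Rplus_comm Rplus_0_l.

Local Notation "\sum_ ( i <- r | P ) F" :=
  (\big[Rplus/0]_(i <- r | P%B) F) : R_scope.
Local Notation "\sum_ ( i <- r ) F" := (\big[Rplus/0]_(i <- r) F) : R_scope.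
Local Notation "\sum_ ( i | P ) F" := (\big[Rplus/0]_(i | P%B) F) : R_scope.
Local Notation "\sum_ i F" := (\big[Rplus/0]_i F) : R_scope.

Lemma rsumE (T : finType) (f : T -> R) : rsum f = \sum_i f i.
Proof. by rewrite /rsum -big_enum /= unlock /= foldr_map. Qed.

Lemma foldr_sumE (I : Type) (r : seq I) (f : I -> R) :
  foldr Rplus 0 (map f r) = \sum_(i <- r) f i.
Proof. by rewrite unlock /= foldr_map. Qed.

Lemma sum_mull (I : Type) (r : seq I) (P : pred I) (F : I -> R) a :
  a * \sum_(i <- r | P i) F i = \sum_(i <- r | P i) (a * F i).
Proof. exact: (big_morph (Rmult a) (Rmult_plus_distr_l a) (Rmult_0_r a)). Qed.

Lemma sum_mulr (I : Type) (r : seq I) (P : pred I) (F : I -> R) a :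
  (\sum_(i <- r | P i) F i) * a = \sum_(i <- r | P i) (F i * a).
Proof.
by rewrite Rmult_comm sum_mull; apply: eq_bigr => i _; rewrite Rmult_comm.
Qed.

Lemma sum_sub (I : Type) (r : seq I) (P : pred I) (F G : I -> R) :
  \sum_(i <- r | P i) F i - \sum_(i <- r | P i) G i =
  \sum_(i <- r | P i) (F i - G i).
Proof.
rewrite /Rminus big_split /=; congr (_ + _).
exact: (big_morph Ropp Ropp_plus_distr Ropp_0).
Qed.

Lemma sum_ge0 (I : Type) (r : seq I) (P : pred I) (F : I -> R) :
  (forall i, P i -> 0 <= F i) -> 0 <= \sum_(i <- r | P i) F i.
Proof.
move=> F0; elim/big_rec: _ => [|i x Pi x0]; first lra.
by have := F0 _ Pi; lra.
Qed.

Lemma sum_ge_term (I : finType) (F : I -> R) i :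
  (forall i, 0 <= F i) -> F i <= \sum_i F i.
Proof.
move=> F0; rewrite (bigD1 i) //=.
have := @sum_ge0 _ (index_enum I) (fun j => j != i) F (fun j _ => F0 j).
lra.
Qed.

Lemma sum_eq0 (I : finType) (F : I -> R) :
  (forall i, 0 <= F i) -> \sum_i F i = 0 -> forall i, F i = 0.
Proof.
by move=> F0 S0 i; have := @sum_ge_term _ F i F0; have := F0 i; lra.
Qed.

(** * Strings and their pairwise data *)

Section PairwiseData.
Variables d n : nat.
Implicit Types (c : P' d n) (x : pt d n) (a b : 'I_n) (j : 'I_n.-1).

Lemma bigmin_le (I : eqType) (r : seq I) (P : pred I) (F : I -> nat) e i :
  i \in r -> P i -> (\big[minn/e]_(i <- r | P i) F i <= F i)%N.
Proof.
move=> + Pi; elim: r => // k r IH; rewrite inE big_cons => /predU1P[<-|/IH{}IH].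
  by rewrite Pi geq_minl.
by case: ifP => // _; apply: leq_trans (geq_minr _ _) IH.
Qed.

Lemma bigmin_attained (I : finType) (P : pred I) (F : I -> nat) e i :
  P i -> (forall i, (F i < e)%N) ->
  exists2 i, P i & \big[minn/e]_(i | P i) F i = F i.
Proof.
move=> Pi Fe.
have := bigmin_le F e (mem_index_enum i) Pi.
have : \big[minn/e]_(i | P i) F i = e \/
       exists2 i, P i & \big[minn/e]_(i | P i) F i = F i.
  elim/big_rec: _ => [|k m Pk]; first by left.
  have [_|] := leqP (F k) m => H; first by right; exists k.
  by case=> [->|[k' ? ->]]; [left | right; exists k'].
by case=> [->|//]; rewrite leqNgt Fe.
Qed.

Lemma mval_sym c a b : mval c a b = mval c b a.
Proof. by rewrite /mval minnC maxnC. Qed.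

Lemma mval_le c a b j :
  (pos c.1 a <= j < pos c.1 b)%N -> (mval c a b <= c.2 j)%N.
Proof.
move=> /andP[aj jb]; rewrite /mval; apply: bigmin_le; first exact: mem_index_enum.
by rewrite geq_min aj leq_max jb orbT.
Qed.

Lemma pos_lt c a : (pos c.1 a < n)%N.
Proof. exact: ltn_ord. Qed.

Lemma mval_attained c a b : before c a b ->
  exists2 j : 'I_n.-1, (pos c.1 a <= j < pos c.1 b)%N & nat_of_ord (c.2 j) = mval c a b.
Proof.
rewrite /before => ab.
have jn : (pos c.1 a < n.-1)%N by have := pos_lt c b; lia.
rewrite /mval (minn_idPl (ltnW ab)) (maxn_idPr (ltnW ab)).
have [|i Pi ->] := @bigmin_attained _ (fun j : 'I_n.-1 => (pos c.1 a <= j < pos c.1 b)%N)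
  (fun j => nat_of_ord (c.2 j)) d (Ordinal jn) _ (fun i => ltn_ord (c.2 i)).
  by rewrite /= leqnn ab.
by exists i.
Qed.

Lemma mval_lt c a b : before c a b -> (mval c a b < d)%N.
Proof. by case/mval_attained=> j _ <-. Qed.

Lemma pos_inj c a b : pos c.1 a = pos c.1 b -> a = b.
Proof. by move/val_inj; apply: perm_inj. Qed.

Lemma before_neq c a b : before c a b -> a != b.
Proof. by rewrite /before; case: eqP => // ->; rewrite ltnn. Qed.

Lemma before_total c a b : a != b -> before c a b \/ before c b a.
Proof.
rewrite /before; case: (ltngtP (pos c.1 a) (pos c.1 b)); [by left|by right|].
by move/pos_inj=> ->; rewrite eqxx.
Qed.

Lemma before_asym c a b : before c a b -> before c b a = false.
Proof. by rewrite /before; lia. Qed.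

Fact ltn_predW j : (j < n)%N. Proof. by have := ltn_ord j; lia. Qed.
Fact ltn_predS j : (j.+1 < n)%N. Proof. by have := ltn_ord j; lia. Qed.

Definition lletter c j : 'I_n := c.1 (Ordinal (ltn_predW j)).
Definition rletter c j : 'I_n := c.1 (Ordinal (ltn_predS j)).

Lemma pos_lletter c j : pos c.1 (lletter c j) = j.
Proof. by rewrite /pos /lletter permK. Qed.

Lemma pos_rletter c j : pos c.1 (rletter c j) = j.+1.
Proof. by rewrite /pos /rletter permK. Qed.

Lemma before_letters c j : before c (lletter c j) (rletter c j).
Proof. by rewrite /before pos_lletter pos_rletter. Qed.

Lemma mval_letters c j : mval c (lletter c j) (rletter c j) = c.2 j.
Proof.
have [i] := mval_attained (before_letters c j).
rewrite pos_lletter pos_rletter ltnS -eqn_leq => /eqP ji <-.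
by congr (nat_of_ord (c.2 _)); apply: val_inj.
Qed.

Lemma preceqP c c' : reflect
  (forall a b, before c' a b ->
     (before c a b /\ (mval c a b <= mval c' a b)%N) \/
     (before c b a /\ (mval c a b < mval c' a b)%N)) (preceq c c').
Proof.
apply: (iffP forallP) => [H a b ab|H a].
  have := H a => /forallP/(_ b); rewrite ab (before_neq ab) /=.
  by case/orP=> /andP[? ?]; [left|right].
apply/forallP=> b; apply/implyP=> /andP[_ /H].
by case=> -[-> ->]; rewrite ?orbT.
Qed.

Lemma preceq_refl : reflexive (@preceq d n).
Proof. by move=> c; apply/preceqP=> a b ab; left. Qed.

(** A reversal of a pair costs a strict inequality of levels. Two reversals restore the order, and a
    single one leaves one strict inequality. *)
Lemma preceq_trans : transitive (@preceq d n).
Proof.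
move=> c2 c1 c3 /preceqP H12 /preceqP H23; apply/preceqP=> a b /H23.
rewrite !(mval_sym _ a b).
by case=> -[/H12]; rewrite ?(mval_sym _ a b) => -[[? ?]|[? ?]] ?; 
   [left|right|right|left]; split=> //; lia.
Qed.

Lemma pos_card c a : pos c.1 a = #|[pred b | before c b a]|.
Proof.
rewrite -[LHS]card_ord -(card_image (f := fun i => c.1 (widen_ord (ltnW (pos_lt c a)) i))).
  apply: eq_card => b; rewrite !inE; apply/imageP/idP => [[i _ ->]|ba].
    by rewrite /before {1}/pos permK /=.
  exists (Ordinal ba) => //.
  rewrite -[LHS](permKV c.1); congr (c.1 _); exact: val_inj.
by move=> i i' /perm_inj /(congr1 val) /= /val_inj.
Qed.

(** The order gives the permutation, a position being the number of letters before it; the level of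
    a step is [mval] of the two neighbouring letters. Comparisons of strings thus reduce to pairs of
    letters. *)
Lemma stringP c c' : (forall a b, before c a b -> before c' a b) ->
  (forall a b, before c a b -> mval c a b = mval c' a b) -> c = c'.
Proof.
move=> B M.
have BB a b : before c a b = before c' a b.
  apply/idP/idP => [/B //|ab]; have [//|/B] := before_total c (before_neq ab).
  by rewrite (before_asym ab).
have E1 : c.1 = c'.1.
  apply: invg_inj; apply/permP=> a; apply: val_inj; rewrite /= -!/(pos _ _).
  by rewrite !pos_card; apply: eq_card => b; rewrite !inE.
have E2 : c.2 = c'.2.
  apply/ffunP=> j; apply: val_inj => /=.
  rewrite -mval_letters M ?before_letters //.
  by rewrite -[in RHS]mval_letters /lletter /rletter E1.
by case: c c' E1 E2 {B M BB} => [? ?] [? ?] /= -> ->.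
Qed.

Lemma preceq_anti c c' : preceq c c' -> preceq c' c -> c = c'.
Proof.
move=> /preceqP H /preceqP H'; apply: stringP => a b ab.
  case: (H' _ _ ab) => -[// ba]; case: (H _ _ ba) => -[?];
  by rewrite !(mval_sym _ b a); lia.
case: (H' _ _ ab) => -[ba]; case: (H _ _ ba) => -[?];
by rewrite ?(mval_sym _ b a); lia.
Qed.

Lemma prec_preceq c c' : prec c c' -> preceq c c'.
Proof. by case/andP. Qed.

Lemma prec_irr c : prec c c = false.
Proof. by rewrite /prec eqxx andbF. Qed.

Lemma preceq_prec_trans c2 c1 c3 : preceq c1 c2 -> prec c2 c3 -> prec c1 c3.
Proof.
move=> H12 /andP[H23 /eqP N]; rewrite /prec (preceq_trans H12 H23) /=.
by apply/eqP=> E; apply: N; apply: preceq_anti; rewrite // -E.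
Qed.

Lemma prec_preceq_trans c2 c1 c3 : prec c1 c2 -> preceq c2 c3 -> prec c1 c3.
Proof.
move=> /andP[H12 /eqP N] H23; rewrite /prec (preceq_trans H12 H23) /=.
by apply/eqP=> E; apply: N; apply: preceq_anti; rewrite // E.
Qed.

Lemma prec_trans : transitive (@prec d n).
Proof. by move=> c2 c1 c3 /prec_preceq; apply: preceq_prec_trans. Qed.

(** If no level increased strictly, no pair could be reversed either, and all levels would agree, so
    [stringP] would identify the two strings. *)
Lemma prec_pair c c' : prec c c' ->
  exists a b, before c a b /\ (mval c a b < mval c' a b)%N.
Proof.
case/andP=> /preceqP H /eqP N.
have [/existsP[a /existsP[b /andP[? ?]]]|/existsPn E] :=
  boolP [exists a, exists b, before c a b && (mval c a b < mval c' a b)%N].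
  by exists a, b.
have E' a b : before c a b -> (mval c' a b <= mval c a b)%N.
  by move=> ab; have := E a => /existsPn/(_ b); rewrite ab /= -leqNgt.
case: N; apply: esym; apply: stringP => a b ab; case: (H _ _ ab) => -[ba] //.
- by have := E' _ _ ba; rewrite !(mval_sym _ b a); lia.
- by have := E' _ _ ba; lia.
- by have := E' _ _ ba; rewrite !(mval_sym _ b a); lia.
Qed.

Lemma vpt_sub c a b k : vpt c b k - vpt c a k = vtilde c b k - vtilde c a k.
Proof. by rewrite /vpt; lra. Qed.

(** The difference of two columns at coordinate [k] counts the steps of level [k] between the two
    letters: none below the minimal level, and at least one at it, which is [vpt_level]. *)
Lemma vpt_below c a b (k : 'I_d) : before c a b -> (k < mval c a b)%N ->
  vpt c a k = vpt c b k.
Proof.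
move=> ab km; apply: Rminus_diag_uniq; rewrite vpt_sub /vtilde.
apply: Rminus_diag_eq; congr INR; apply: eq_card => j; rewrite !inE.
have [/eqP jk|] := boolP (c.2 j == k); rewrite ?andbF //= !andbT.
apply/idP/idP; first by move=> ja; apply: ltn_trans ja ab.
move=> jb; rewrite ltnNge; apply/negP=> aj.
have /mval_le : (pos c.1 a <= j < pos c.1 b)%N by rewrite aj.
by rewrite jk; lia.
Qed.

Lemma vpt_level c a b (k : 'I_d) : before c a b -> k = mval c a b :> nat ->
  1 <= vpt c b k - vpt c a k.
Proof.
move=> ab km; rewrite vpt_sub /vtilde -minus_INR; last first.
  apply/leP/subset_leq_card/subsetP=> j; rewrite !inE => /andP[ja ->].
  by rewrite (ltn_trans ja ab).
rewrite -[1]/(INR 1); apply/le_INR/leP.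
have [j /andP[aj jb] jm] := mval_attained ab.
suff : (#|[pred j : 'I_n.-1 | (j < pos c.1 a)%N && (c.2 j == k)]| <
        #|[pred j : 'I_n.-1 | (j < pos c.1 b)%N && (c.2 j == k)]|)%N by rewrite subn_gt0.
apply/proper_card/properP; split.
  apply/subsetP=> i; rewrite !inE => /andP[ja ->].
  by rewrite (ltn_trans ja ab).
exists j; rewrite !inE; last by rewrite ltnNge aj.
by rewrite jb -val_eqE /= jm km eqxx.
Qed.

Definition lexlt x a b (k : 'I_d) :=
  x a k < x b k /\ forall k' : 'I_d, (k' < k)%N -> x a k' = x b k'.

(** The source of the minimum in [mval]: along sorted columns, the first differing coordinates
    combine by taking the smaller one. *)
Lemma lexlt_trans x a b e k k' : lexlt x a b k -> lexlt x b e k' ->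
  lexlt x a e (if (k <= k')%N then k else k').
Proof.
case=> ab Eab [be Ebe]; case: leqP => kk; split.
- have [E|?] : k = k' \/ (k < k')%N.
    by case: (ltngtP k k') kk => // [|/val_inj]; [right|left].
    by subst k'; lra.
  by rewrite -Ebe.
- by move=> i ik; rewrite Eab // Ebe //; lia.
- by rewrite Eab.
- by move=> i ik; rewrite Eab ?Ebe //; lia.
Qed.

Lemma lexlt_total x a b : config_space x -> a != b ->
  exists k, lexlt x a b k \/ lexlt x b a k.
Proof.
move=> xF /eqP /xF ab.
have [k0 k0P] : exists k, ~~ Req_dec_T (x a k) (x b k).
  apply: NNPP => H; apply: ab; apply: functional_extensionality => k.
  case E : (Req_dec_T (x a k) (x b k)) => //.
  by case: H; exists k; rewrite E.
case: (@arg_minnP _ k0 (fun k => ~~ Req_dec_T (x a k) (x b k)) (@nat_of_ord d) k0P)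
  => k kP kmin; exists k.
have E (k' : 'I_d) : (k' < k)%N -> x a k' = x b k'.
  move=> k'k; case E : (Req_dec_T (x a k') (x b k')) => //.
  have : (k <= k')%N by apply: kmin; rewrite E.
  by lia.
case: (Req_dec_T (x a k) (x b k)) kP => //= N _.
case: (Rtotal_order (x a k) (x b k)) => [?|[?|?]]; [by left|lra|right].
by split=> // k' k'k; rewrite E.
Qed.

Lemma lexlt_irr x a k : ~ lexlt x a a k.
Proof. by case; lra. Qed.

(** Sort the columns lexicographically. The position of a letter is the number of smaller columns,
    and the level of a step is the first coordinate in which the two neighbours differ. *)
Lemma lex_stratum x : config_space x ->
  exists c, forall a b, before c a b ->
    forall k : 'I_d, k = mval c a b :> nat -> lexlt x a b k.
Proof.
move=> xF.
pose lt a b : bool := excluded_middle_informative (exists k, lexlt x a b k).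
have ltP a b : reflect (exists k, lexlt x a b k) (lt a b).
  by rewrite /lt; case: excluded_middle_informative => ?; constructor.
have ltT a b e : lt a b -> lt b e -> lt a e.
  case/ltP=> k ab /ltP[k' be]; apply/ltP.
  by have := lexlt_trans ab be; eexists; eauto.
have lt_irr a : ~~ lt a a by apply/ltP=> -[k /lexlt_irr].
have lt_tot a b : a != b -> lt a b || lt b a.
  case/(lexlt_total xF)=> k [H|H]; apply/orP; [left|right]; apply/ltP; by exists k.
pose rk a := #|[pred b | lt b a]|.
have rk_lt a b : lt a b -> (rk a < rk b)%N.
  move=> ab; apply/proper_card/properP; split; last first.
    by exists a; rewrite !inE // (negPf (lt_irr a)).
  by apply/subsetP=> e; rewrite !inE => /ltT; apply.
have rk_n a : (rk a < n)%N.
  rewrite -[X in (_ < X)%N]card_ord; apply/proper_card/properP; split; first exact/subsetP.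
  by exists a; rewrite // !inE (negPf (lt_irr a)).
have rk_inj : injective (fun a => Ordinal (rk_n a)).
  move=> a b /(congr1 val) /= E; apply/eqP/negPn/negP=> /lt_tot /orP[] /rk_lt; lia.
pose s := ((perm rk_inj)^-1)%g.
have poss a : pos s a = rk a by rewrite /pos /s invgK permE.
have posE a b : (pos s a < pos s b)%N -> lt a b.
  rewrite !poss => H; have [E|/lt_tot/orP[//|/rk_lt]] := eqVneq a b; last by lia.
  by rewrite E ltnn in H.
have [f fP] : exists f : 'I_n.-1 -> 'I_d, forall j,
    lexlt x (s (Ordinal (ltn_predW j))) (s (Ordinal (ltn_predS j))) (f j).
  apply: (@fin_all_exists _ (fun=> 'I_d) (fun j k => lexlt x
    (s (Ordinal (ltn_predW j))) (s (Ordinal (ltn_predS j))) k)) => j; apply/ltP/posE.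
  by rewrite /pos !permK /=.
exists (s, [ffun j => f j]); set c := (s, _).
(* Induction on the distance of the letters: their first differing coordinate bounds the levels in
   between from below and is one of them, so it is their minimum. *)
have main m a b : (pos s b = (pos s a + m).+1)%N ->
    exists k : 'I_d, [/\ lexlt x a b k,
      forall j, (pos s a <= j < pos s b)%N -> (k <= f j)%N &
      exists2 j : 'I_n.-1, (pos s a <= j < pos s b)%N & f j = k].
  elim: m b => [|m IH] b E.
    have jn : (pos s a < n.-1)%N by have := pos_lt c b; rewrite /=; lia.
    have := fP (Ordinal jn).
    have -> : s (Ordinal (ltn_predW (Ordinal jn))) = a.
      by rewrite -[RHS](permKV s); congr (s _); apply: val_inj.
    have -> : s (Ordinal (ltn_predS (Ordinal jn))) = b.
      by rewrite -[RHS](permKV s); congr (s _); apply: val_inj; rewrite /= -/(pos s b) E addn0.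
    move=> H; exists (f (Ordinal jn)); split=> //.
      move=> j ?; have -> // : j = Ordinal jn by apply: val_inj => /=; lia.
    by exists (Ordinal jn) => //=; lia.
  have jn : (pos s a + m.+1 < n.-1)%N by have := pos_lt c b; rewrite /=; lia.
  set j0 := Ordinal jn.
  pose b' := s (Ordinal (ltn_predW j0)).
  have pb' : pos s b' = (pos s a + m).+1 by rewrite /pos /b' permK /= addnS.
  have [k [ab' kmin [j1 j1P kE]]] := IH _ pb'.
  have := fP j0.
  have -> : s (Ordinal (ltn_predS j0)) = b.
    by rewrite -[RHS](permKV s); congr (s _); apply: val_inj; rewrite /= -/(pos s b) E.
  rewrite -/b' => /(lexlt_trans ab') H.
  exists (if (k <= f j0)%N then k else f j0); split => //.
    move=> j jP; have [jj|jj] := ltnP j (pos s b').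
      have : (k <= f j)%N by apply: kmin; lia.
      by case: (leqP k (f j0)); lia.
    have -> : j = j0 by apply: val_inj => /=; lia.
    by case: (leqP k (f j0)).
  case: (leqP k (f j0)) => _; last by exists j0 => //=; lia.
  by exists j1 => //; lia.
move=> a b ab k kE.
have [k' [H kmin [j jP jE]]] := main (pos s b - (pos s a).+1)%N a b
   ltac:(move: ab; rewrite /before /=; lia).
suff -> : k = k' by [].
apply: val_inj; rewrite /= kE.
have := @mval_le c a b j jP; rewrite /= ffunE jE => le1.
have [j' j'P] := mval_attained ab; rewrite /= ffunE => E'.
by have := kmin _ j'P; rewrite E'; lia.
Qed.

End PairwiseData.

(** * Continuity at a point *)

Section Continuity.
Variables (A : Type) (dA : A -> A -> R) (S : A -> Prop) (a : A).

Definition near (P : A -> Prop) :=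
  exists delta, 0 < delta /\ forall y, S y -> dA a y < delta -> P y.

Definition cvat (f : A -> R) :=
  forall eps, 0 < eps -> near (fun y => Rabs (f y - f a) < eps).

Lemma near_true (P : A -> Prop) : (forall y, S y -> P y) -> near P.
Proof. by move=> H; exists 1; split; [lra|move=> y /H]. Qed.

Lemma near_and P Q : near P -> near Q -> near (fun y => P y /\ Q y).
Proof.
move=> [e [e0 eP]] [f [f0 fQ]]; exists (Rmin e f); split; first exact: Rmin_pos.
by move=> y Sy lt; have := Rmin_l e f; have := Rmin_r e f; split;
  [apply: eP|apply: fQ] => //; lra.
Qed.

Lemma near_imp (P Q : A -> Prop) : (forall y, S y -> P y -> Q y) -> near P -> near Q.
Proof. by move=> PQ [e [e0 eP]]; exists e; split=> // y Sy /(eP _ Sy); apply: PQ. Qed.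

Lemma near_all (I : finType) (P : I -> A -> Prop) :
  (forall i, near (P i)) -> near (fun y => forall i, P i y).
Proof.
move=> H.
suff : near (fun y => forall i, i \in enum I -> P i y).
  by apply: near_imp => y _ Hy i; apply: Hy; rewrite mem_enum.
elim: (enum I) => [|i r IH]; first exact: near_true.
apply: near_imp (near_and (H i) IH) => y _ [Hi Hr] k.
by rewrite inE => /predU1P[->|/Hr].
Qed.

Lemma cvat_cst r : cvat (fun=> r).
Proof. by move=> e e0; apply: near_true => y _; rewrite Rminus_diag Rabs_R0. Qed.

Lemma cvat_ext (f g : A -> R) : (forall y, f y = g y) -> cvat f -> cvat g.
Proof. by move=> E H e /H; apply: near_imp => y _; rewrite !E. Qed.

Lemma cvat_add f g : cvat f -> cvat g -> cvat (fun y => f y + g y).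
Proof.
move=> cf cg e e0; have e2 : 0 < e / 2 by lra.
apply: near_imp (near_and (cf _ e2) (cg _ e2)) => y _ [].
by rewrite /Rabs; do 3 case: Rcase_abs; lra.
Qed.

Lemma cvat_comp g f : continuity_pt g (f a) -> cvat f -> cvat (fun y => g (f y)).
Proof.
move=> cg cf e e0; have [al [al0 H]] := cg e e0.
apply: near_imp (cf _ al0) => y _ lt.
have [->|N] := Req_dec_T (f y) (f a); first by rewrite Rminus_diag Rabs_R0.
by apply: H; split=> //; split=> //; apply: not_eq_sym.
Qed.

Lemma cvat_scal r f : cvat f -> cvat (fun y => r * f y).
Proof.
apply: (cvat_comp (g := Rmult r)).
apply: continuity_pt_mult; first by apply: continuity_pt_const.
exact: derivable_continuous_pt (derivable_pt_id _).
Qed.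

Lemma cvat_sub f g : cvat f -> cvat g -> cvat (fun y => f y - g y).
Proof.
move=> cf cg; apply: (cvat_ext (f := fun y => f y + -1 * g y)); first by move=> y; lra.
exact: cvat_add cf (cvat_scal _ cg).
Qed.

Lemma cvat_mul f g : cvat f -> cvat g -> cvat (fun y => f y * g y).
Proof.
move=> cf cg.
apply: (cvat_ext (f := fun y => / 4 * (Rsqr (f y + g y) - Rsqr (f y - g y)))).
  by move=> y; rewrite /Rsqr; field.
have sq x : continuity_pt Rsqr x.
  exact: derivable_continuous_pt (derivable_pt_Rsqr _).
by apply: cvat_scal; apply: cvat_sub; apply: (cvat_comp (g := Rsqr)) => //;
  [apply: cvat_add|apply: cvat_sub].
Qed.

Lemma cvat_div f g : g a <> 0 -> cvat f -> cvat g -> cvat (fun y => f y / g y).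
Proof.
move=> ga cf cg; apply: cvat_mul => //; apply: (cvat_comp (g := Rinv) (f := g)) => //.
apply: (continuity_pt_inv id) => //.
exact: derivable_continuous_pt (derivable_pt_id _).
Qed.

Lemma cvat_min f g : cvat f -> cvat g -> cvat (fun y => Rmin (f y) (g y)).
Proof.
move=> cf cg e e0; apply: near_imp (near_and (cf _ e0) (cg _ e0)) => y _ [].
by rewrite /Rmin; do 2 case: Rle_dec => ?; rewrite /Rabs; do ?case: Rcase_abs; lra.
Qed.

Lemma cvat_sum (I : Type) (r : seq I) (P : pred I) (F : I -> A -> R) :
  (forall i, cvat (F i)) -> cvat (fun y => \sum_(i <- r | P i) F i y).
Proof.
move=> H; elim: r => [|i r IH].
  by apply: (cvat_ext (f := fun=> 0)); [move=> y; rewrite big_nil|apply: cvat_cst].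
case Pi : (P i).
  apply: (cvat_ext (f := fun y => F i y + \sum_(i <- r | P i) F i y)).
    by move=> y; rewrite big_cons Pi.
  exact: cvat_add.
by apply: (cvat_ext (f := fun y => \sum_(i <- r | P i) F i y)) => // y; rewrite big_cons Pi.
Qed.

Lemma cvat_neg f : cvat f -> f a < 0 -> near (fun y => f y < 0).
Proof.
move=> cf fa; have e0 : 0 < - f a by lra.
by apply: near_imp (cf _ e0) => y _; rewrite /Rabs; case: Rcase_abs; lra.
Qed.

Lemma cvat_neq f g : cvat f -> cvat g -> f a <> g a -> near (fun y => f y <> g y).
Proof.
move=> cf cg N; have e0 : 0 < Rabs (f a - g a) by apply: Rabs_pos_lt; lra.
apply: near_imp (cvat_sub cf cg e0) => y _ + E.
by rewrite E Rminus_diag Rminus_0_l Rabs_Ropp; lra.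
Qed.

(** A squeeze, meant for the centre of a ball, where polar formulas divide by a quantity that
    vanishes. *)
Lemma cvat_zero f g : cvat g -> f a = 0 -> g a = 0 ->
  (forall y, Rabs (f y) <= g y) -> cvat f.
Proof.
move=> cg fa ga fg e e0; apply: near_imp (cg _ e0) => y _.
rewrite fa ga !Rminus_0_r => H; apply: Rle_lt_trans (fg y) _.
by move: H; rewrite /Rabs; case: Rcase_abs; lra.
Qed.

End Continuity.

(** * Strata relative to a string *)

Section RelativeStrata.
Variables (d n : nat) (T : P' d n).
Implicit Types (c e : P' d n) (x : pt d n) (a b : 'I_n) (k : 'I_d).

Definition flat x := forall a b k, before T a b -> (k < mval T a b)%N -> x a k = x b k.

(* [x] lies in the stratum [c] after translation by a large multiple of [vpt T]:
   differences of columns only matter below the level at which [T] separates them. *)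
Definition strat x c := preceq c T /\ forall a b, before c a b -> forall k,
  ((k < mval c a b)%N -> x a k = x b k) /\
  (k = mval c a b :> nat -> (k < mval T a b)%N -> x a k < x b k).

Definition wstrat x c := preceq c T /\ forall a b, before c a b -> forall k,
  ((k < mval c a b)%N -> x a k = x b k) /\
  (k = mval c a b :> nat -> (k < mval T a b)%N -> x a k <= x b k).

Lemma strat_wstrat x c : strat x c -> wstrat x c.
Proof.
case=> cT H; split=> // a b ab k; have [H1 H2] := H a b ab k; split=> // E lt.
by have := H2 E lt; lra.
Qed.

Lemma preceq_mval c a b : preceq c T -> (mval c a b <= mval T a b)%N.
Proof.
move=> /preceqP H; have [<-|N] := eqVneq a b.
  by rewrite /mval minnn maxnn !big_pred0 // => j; lia.
have [/H|/H] := before_total T N; rewrite !(mval_sym _ a b); case=> -[]; lia.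
Qed.

Lemma preceq_tie c a b : preceq c T -> before c a b -> mval c a b = mval T a b ->
  before T a b.
Proof.
move=> /preceqP H ab E; have [//|/H] := before_total T (before_neq ab).
rewrite (before_asym ab) !(mval_sym _ b a) E; case=> -[]; lia.
Qed.

(** If [e] separated two letters at a lower level than [c], that coordinate would be both equal and
    strictly ordered. A reversal at equal levels gives contradictory inequalities, or, at the level
    of [T], contradicts the order that [T] then imposes on both strings. The converse is
    [strat_preceq]. *)
Lemma wstrat_preceq x c e : wstrat x c -> strat x e -> preceq c e.
Proof.
move=> [cT Hc] [eT He]; apply/preceqP=> a b ab.
have le_eT := preceq_mval a b eT.
have key (ab' : before c a b \/ before c b a) : (mval c a b <= mval e a b)%N.
  rewrite leqNgt; apply/negP=> lt.
  have [_ /(_ erefl) H2] := He a b ab (Ordinal (mval_lt ab)).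
  have {H2} := H2 (leq_trans lt (preceq_mval a b cT)).
  case: ab' => ab'; have [/= H _] := Hc _ _ ab' (Ordinal (mval_lt ab)).
    by rewrite H //; lra.
  by rewrite H ?(mval_sym c b a) //; lra.
have [cab|cba] := before_total c (before_neq ab); first by left; split=> //; apply: key; left.
right; split=> //; rewrite ltn_neqAle key; last by right.
rewrite andbT; apply/eqP=> E.
have [lt|ge] := ltnP (mval e a b) (mval T a b).
  have [_ /(_ erefl lt) lt1] := He a b ab (Ordinal (mval_lt ab)).
  have [_ /=] := Hc b a cba (Ordinal (mval_lt ab)).
  rewrite !(mval_sym _ b a) => /(_ (esym E) lt); lra.
have E' : mval e a b = mval T a b by lia.
have := preceq_tie eT ab E'.
have -> // := before_asym (c := T) (a := b) (b := a).
by apply: (preceq_tie cT cba); rewrite !(mval_sym _ b a) E.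
Qed.

Lemma strat_uniq x c e : strat x c -> strat x e -> c = e.
Proof.
by move=> xc xe; apply: preceq_anti; apply: wstrat_preceq (strat_wstrat _) _; eauto.
Qed.

Lemma strat_preceq x c e : preceq c e -> strat x e -> wstrat x c.
Proof.
move=> ce [eT He]; split; first exact: preceq_trans ce eT.
move=> a b ab k; move/preceqP: ce => ce.
have [/[dup] eab /ce|/[dup] eba /ce] := before_total e (before_neq ab).
  rewrite (before_asym ab) => -[[_ le]|[//]].
  have [H1 H2] := He a b eab k; split=> [lt|E lt]; first by apply: H1; lia.
  have [E'|N] := eqVneq (mval c a b) (mval e a b).
    by have := H2 (etrans E E') lt; lra.
  by rewrite H1; (lra || lia).
rewrite (before_asym ab) !(mval_sym _ b a) => -[[//]|[_ lt]].
have [H1 _] := He b a eba k; rewrite mval_sym in H1.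
by split=> [|E _]; [move=> ?|]; rewrite H1; (lra || lia).
Qed.

Lemma strat_top x : strat x T <-> flat x.
Proof.
split=> [[_ H] a b k ab|H]; first by have [] := H a b ab k.
split; first exact: preceq_refl.
by move=> a b ab k; split=> [|-> /[!ltnn]//]; apply: H.
Qed.

Definition sub x (w : R) c : pt d n := fun a k => x a k - w * vpt c a k.

(** By [vpt_level], adding a positive multiple of [vpt c] turns each weak inequality into a strict
    one. *)
Lemma wstrat_add x w c : 0 < w -> wstrat (sub x w c) c -> strat x c.
Proof.
move=> w0 [cT H]; split=> // a b ab k; have [H1 H2] := H a b ab k.
split=> [lt|E lt]; rewrite /sub in H1 H2.
  by have := H1 lt; rewrite (vpt_below ab lt); lra.
by have := H2 E lt; have := vpt_level ab E; nra.
Qed.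

(** These triples index the strict inequalities of the stratum [c] that are still visible relative
    to [T]. The coordinate is part of the triple because [mval] is only a [nat]. *)
Definition bound_pair c (t : 'I_n * 'I_n * 'I_d) :=
  [&& before c t.1.1 t.1.2, t.2 == mval c t.1.1 t.1.2 :> nat
    & (t.2 < mval T t.1.1 t.1.2)%N].

Definition ratio c x (t : 'I_n * 'I_n * 'I_d) :=
  (x t.1.2 t.2 - x t.1.1 t.2) / (vpt c t.1.2 t.2 - vpt c t.1.1 t.2).

(* The largest [w] for which [sub x w c] stays in the closed stratum [c], provided
   [prec c T]; the default [0] only serves an empty family of constraints. *)
Definition mu c x : R :=
  let r := [seq ratio c x t | t <- enum (bound_pair c)] in foldr Rmin (head 0 r) r.

Lemma foldr_min_le (I : eqType) (f : I -> R) r z i :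
  i \in r -> foldr Rmin z (map f r) <= f i.
Proof.
elim: r => //= k r IH; rewrite inE => /predU1P[->|/IH H]; first exact: Rmin_l.
by apply: Rle_trans (Rmin_r _ _) H.
Qed.

Lemma foldr_min_attained (I : eqType) (f : I -> R) r z :
  foldr Rmin z (map f r) = z \/ exists2 i, i \in r & foldr Rmin z (map f r) = f i.
Proof.
elim: r => [|k r IH] /=; first by left.
rewrite {1 3}/Rmin; case: Rle_dec => _; first by right; exists k; rewrite ?mem_head.
by case: IH => [->|[i ir ->]]; [left|right; exists i; rewrite // inE ir orbT].
Qed.

Lemma mu_le c x t : bound_pair c t -> mu c x <= ratio c x t.
Proof. by move=> ct; apply: foldr_min_le; rewrite mem_enum. Qed.

Lemma mu_attained c x : prec c T -> exists2 t, bound_pair c t & mu c x = ratio c x t.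
Proof.
move=> /prec_pair[a [b [ab lt]]].
have t0 : (a, b, Ordinal (mval_lt ab)) \in enum (bound_pair c).
  by rewrite mem_enum; apply/and3P; split.
rewrite /mu; case: (foldr_min_attained (ratio c x) (enum (bound_pair c))
   (head 0 [seq ratio c x t | t <- enum (bound_pair c)])) => [->|[t]]; last first.
  by rewrite mem_enum => ct ->; exists t.
case E : (enum _) t0 => [//|t r] _; exists t => //.
have : t \in enum (bound_pair c) by rewrite E mem_head.
by rewrite mem_enum.
Qed.

Lemma bound_pair_pos c t : bound_pair c t ->
  1 <= vpt c t.1.2 t.2 - vpt c t.1.1 t.2.
Proof. by case/and3P=> ab /eqP E _; apply: vpt_level. Qed.

(** Being in the closed stratum [c] bounds [w] by every ratio; a pair that [e] separates at a higher
    level than [c] has lost its gap, so its ratio equals [w]. This form, free of enumerations, is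
    the one that can be compared under permutations. *)
Lemma tight_pair x w c e : prec c e -> strat (sub x w c) e ->
  (forall t, bound_pair c t -> w <= ratio c x t) /\
  exists2 t, bound_pair c t & w = ratio c x t.
Proof.
move=> ce xe; have [cT H] := strat_preceq (prec_preceq ce) xe; split.
  move=> t /[dup] /bound_pair_pos D /and3P[ab /eqP E lt].
  apply: (Rmult_le_reg_r (vpt c t.1.2 t.2 - vpt c t.1.1 t.2)); first lra.
  rewrite /ratio /Rdiv Rmult_assoc Rinv_l ?Rmult_1_r; last lra.
  by have [_ /(_ E lt)] := H _ _ ab t.2; rewrite /sub; lra.
have [a [b [ab lt]]] := prec_pair ce.
pose k := Ordinal (mval_lt ab); have [eT He] := xe.
have bt : bound_pair c (a, b, k).
  by apply/and3P; split=> //=; apply: leq_trans lt (preceq_mval a b eT).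
exists (a, b, k) => //; have /= := bound_pair_pos bt.
rewrite /ratio /= => D.
have E : sub x w c a k = sub x w c b k.
  have [eab|eba] := before_total e (before_neq ab).
    by have [H1 _] := He _ _ eab k; apply: H1.
  by have [H1 _] := He _ _ eba k; rewrite H1 // mval_sym.
by move: E; rewrite /sub => E; field_simplify_eq; lra.
Qed.

Lemma tight_mu x w c e : prec c e -> strat (sub x w c) e -> mu c x = w.
Proof.
move=> ce xe; have [H [t ct E]] := tight_pair ce xe; have := mu_le x ct.
have [t' ct' E'] := mu_attained x (prec_preceq_trans ce xe.1).
by have := H _ ct'; lra.
Qed.

End RelativeStrata.

(** * Greedy decomposition along chains *)

Section Decomposition.
Variables (d n : nat) (T : P' d n).
Implicit Types (c e : P' d n) (x : pt d n) (l : seq (R * P' d n)).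

Lemma strat_exists x : exists c, strat T x c.
Proof.
pose B := \sum_a \sum_b \sum_k Rabs (x a k - x b k).
have xB a b k : Rabs (x a k - x b k) <= B.
  have H1 := @sum_ge_term _ (fun k => Rabs (x a k - x b k)) k (fun _ => Rabs_pos _).
  have H2 := @sum_ge_term _ (fun b => \sum_k Rabs (x a k - x b k)) b
    (fun b => sum_ge0 _ (fun _ _ => Rabs_pos _)).
  have H3 := @sum_ge_term _ (fun a => \sum_b \sum_k Rabs (x a k - x b k)) a
    (fun a => sum_ge0 _ (fun b _ => sum_ge0 _ (fun _ _ => Rabs_pos _))).
  by rewrite /B; cbv beta in H1, H2, H3; lra.
(* [B] bounds all differences of columns, and those of [vpt T] are at least 1 at their level. Hence
   [z] is ordered as in [T] at the levels of [T], so it has no collisions, while below these levels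
   its differences are those of [x]. *)
pose z : pt d n := fun a k => x a k + (B + 1) * vpt T a k.
have zlt a b (k : 'I_d) : before T a b -> (k < mval T a b)%N ->
    z b k - z a k = x b k - x a k.
  by move=> ab lt; rewrite /z (vpt_below ab lt); lra.
have zeq a b (k : 'I_d) : before T a b -> k = mval T a b :> nat -> z a k < z b k.
  move=> ab E; have := vpt_level ab E; have := xB a b k; have := Rabs_pos (x a k - x b k).
  have := Rle_abs (x a k - x b k); rewrite /z; nra.
have zF : config_space z.
  move=> a b /eqP N E.
  have [ab|ab] := before_total T N; have := zeq _ _ (Ordinal (mval_lt ab)) ab erefl;
  by rewrite E; lra.
have [c cP] := lex_stratum zF; exists c.
have cT : preceq c T.
  apply/preceqP=> a b ab; have lt := zeq _ _ (Ordinal (mval_lt ab)) ab erefl.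
  have [cab|cba] := before_total c (before_neq ab); [left|right]; split=> //.
    have [_ H] := cP _ _ cab _ (erefl : nat_of_ord (Ordinal (mval_lt cab)) = _).
    rewrite leqNgt; apply/negP=> lt'; have := H (Ordinal (mval_lt ab)) lt'; lra.
  have [lt1 H] := cP _ _ cba _ (erefl : nat_of_ord (Ordinal (mval_lt cba)) = _).
  rewrite mval_sym ltnNge; apply/negP=> le.
  have [E|N] := eqVneq (mval T a b) (mval c b a).
    have EE : Ordinal (mval_lt ab) = Ordinal (mval_lt cba) by apply: val_inj.
    by rewrite EE in lt; lra.
  have := H (Ordinal (mval_lt ab)); rewrite /= ltn_neqAle N le => /(_ isT); lra.
split=> // a b ab k.
have [lt1 H] := cP _ _ ab _ (erefl : nat_of_ord (Ordinal (mval_lt ab)) = _).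
have zx k' : (k' < mval T a b)%N -> forall k : 'I_d, k = k' :> nat ->
    z b k - z a k = x b k - x a k.
  move=> lt k0 E; have [Tab|Tba] := before_total T (before_neq ab).
    by apply: zlt => //; rewrite E.
  by have := zlt _ _ k0 Tba; rewrite mval_sym E => /(_ lt); lra.
split=> [lt|E lt].
  by have := H k lt; have := zx k (leq_trans lt (preceq_mval a b cT)) _ erefl; lra.
have EE : k = Ordinal (mval_lt ab) by apply: val_inj.
by have := zx _ lt _ erefl; rewrite EE; lra.
Qed.

(** The minimal ratio leaves all inequalities weakly true, which gives [preceq c e], and turns one
    of them into an equality, which excludes [e = c]. *)
Lemma strat_erode x c : prec c T -> strat T x c ->
  0 < mu T c x /\ forall e, strat T (sub x (mu T c x) c) e -> prec c e.
Proof.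
move=> cT xc; have [t ct E] := mu_attained x cT; have := bound_pair_pos ct => D.
have muD : mu T c x * (vpt c t.1.2 t.2 - vpt c t.1.1 t.2) = x t.1.2 t.2 - x t.1.1 t.2.
  by rewrite E /ratio; field; lra.
have /and3P[ab /eqP kE lt] := ct; have [_ H] := xc.
split; first by have [_ /(_ kE lt)] := H _ _ ab t.2; nra.
move=> e xe.
have ce : preceq c e.
  apply: (wstrat_preceq _ xe); split; first exact: prec_preceq.
  move=> a b cab k; have [H1 H2] := H a b cab k; split=> [ltk|Ek ltk]; rewrite /sub.
    by rewrite (H1 ltk) (vpt_below cab ltk).
  have bt : bound_pair T c (a, b, k) by apply/and3P; split=> //=; apply/eqP.
  have D' := bound_pair_pos bt; rewrite /= in D'.
  have := mu_le x bt; rewrite /ratio /= => le.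
  have := Rmult_le_compat_r _ _ _ (Rle_trans _ _ _ Rle_0_1 D') le.
  by rewrite /Rdiv Rmult_assoc Rinv_l; lra.
rewrite /prec ce; apply/eqP=> ce'; subst e; have [_ H'] := xe.
by have [_ /(_ kE lt)] := H' _ _ ab t.2; rewrite /sub; lra.
Qed.

(** The default of [head] makes [T] the successor of the last string, so the whole chain lies
    strictly below [T]. *)
Fixpoint decomp l x : Prop :=
  if l is (w, c) :: l' then
    [/\ 0 < w, prec c (head T (unzip2 l')) & decomp l' (sub x w c)]
  else flat T x.

(** The closed cone of a chain: in a limit, coefficients may vanish. *)
Fixpoint wdecomp l x : Prop :=
  if l is (w, c) :: l' then
    [/\ 0 <= w, prec c (head T (unzip2 l')) & wdecomp l' (sub x w c)]
  else flat T x.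

(** Inductively the remainder lies in the stratum of the next string, hence in the closed stratum
    [c]; adding [vpt c] moves it into the stratum itself. So the point determines the head of its
    chain. *)
Lemma decomp_strat l x : decomp l x -> strat T x (head T (unzip2 l)).
Proof.
elim: l x => [|[w c] l IH] x /=; first by move=> H; apply/strat_top.
by case=> w0 ch /IH /(strat_preceq (prec_preceq ch)); apply: wstrat_add.
Qed.

Lemma decomp_mu w c l x : decomp ((w, c) :: l) x -> mu T c x = w.
Proof. by case=> _ ch /decomp_strat; apply: tight_mu. Qed.

Lemma decomp_head_top w c l x : decomp ((w, c) :: l) x -> prec c T.
Proof. by case=> _ ch /decomp_strat[hT _]; exact: prec_preceq_trans ch hT. Qed.

(** The head is the stratum of [x] and its coefficient is [mu], so both lists can be peeled in
    parallel; an empty list means the stratum [T]. *)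
Lemma decomp_uniq l l' x : decomp l x -> decomp l' x -> l = l'.
Proof.
elim: l l' x => [|[w c] l IH] [|[w' c'] l'] x // D D'.
- by have /= E := strat_uniq (decomp_strat D) (decomp_strat D');
    have := decomp_head_top D'; rewrite -E prec_irr.
- by have /= E := strat_uniq (decomp_strat D) (decomp_strat D');
    have := decomp_head_top D; rewrite E prec_irr.
have E := strat_uniq (decomp_strat D') (decomp_strat D); rewrite /= in E; subst c'.
have E := decomp_mu D; rewrite (decomp_mu D') in E; subst w'.
by congr (_ :: _); case: D D' => _ _ D [_ _]; apply: IH D.
Qed.

(** Each erosion moves strictly up, so the number of strings above the current stratum decreases. *)
Lemma decomp_exists x : exists l, decomp l x.
Proof.
have [c xc] := strat_exists x.
have [m] := ubnP #|[pred e | prec c e]|; elim: m x c xc => // m IH x c xc lt.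
have [cT|cT] := eqVneq c T.
  by subst c; exists [::]; apply/strat_top.
have {}cT : prec c T by rewrite /prec cT andbT; case: xc.
have [w0 H] := strat_erode cT xc.
have [e xe] := strat_exists (sub x (mu T c x) c).
have ce := H _ xe.
have [|l D] := IH _ _ xe; last first.
  exists ((mu T c x, c) :: l) => /=; split=> //.
  by rewrite (strat_uniq (decomp_strat D) xe).
move: lt; rewrite ltnS; apply: leq_trans; apply/proper_card/properP; split.
  by apply/subsetP=> f; rewrite !inE; apply: prec_trans.
by exists e; rewrite !inE ?prec_irr.
Qed.

Definition greedy x : seq (R * P' d n) :=
  proj1_sig (constructive_indefinite_description _ (decomp_exists x)).

Lemma greedyP x : decomp (greedy x) x.
Proof. exact: proj2_sig (constructive_indefinite_description _ (decomp_exists x)). Qed.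

Definition wt l c : R := \sum_(p <- l | p.2 == c) p.1.

Lemma wt_cons w e l c : wt ((w, e) :: l) c = (if e == c then w else 0) + wt l c.
Proof. by rewrite /wt big_cons /=; case: ifP => _ //; rewrite Rplus_0_l. Qed.

Definition W x c : R := wt (greedy x) c.

Lemma decompW l x c : decomp l x -> W x c = wt l c.
Proof. by move=> D; rewrite /W (decomp_uniq (greedyP x) D). Qed.

Lemma flat_sub x y : flat T (fun a k => x a k - y a k) -> flat T x <-> flat T y.
Proof.
by move=> H; split=> Hx a b k ab lt; have := Hx _ _ _ ab lt; have := H _ _ _ ab lt; lra.
Qed.

Lemma flat_ext x y : (forall a k, x a k = y a k) -> flat T x -> flat T y.
Proof. by move=> E H a b k ab lt; rewrite -!E; apply: H. Qed.

Lemma decomp_flat l x y : flat T (fun a k => x a k - y a k) -> decomp l x -> decomp l y.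
Proof.
elim: l x y => [|[w c] l IH] x y H /=; first by have [] := flat_sub H.
case=> w0 ch D; split=> //; apply: IH D.
by apply: flat_ext H => a k; rewrite /sub; lra.
Qed.

Lemma W_flat x y c : flat T (fun a k => x a k - y a k) -> W x c = W y c.
Proof.
move=> H; apply: decompW; apply: decomp_flat (greedyP y) => a b k ab lt.
by have := H _ _ _ ab lt; lra.
Qed.

Lemma decomp_scal r l x : 0 < r -> decomp l x ->
  decomp [seq (r * p.1, p.2) | p <- l] (fun a k => r * x a k).
Proof.
move=> r0; elim: l x => [|[w c] l IH] x /=.
  by move=> H a b k ab lt; rewrite (H _ _ _ ab lt).
case=> w0 ch /IH D; split; first exact: Rmult_lt_0_compat.
  by rewrite /unzip2 -map_comp.
apply: decomp_flat D => a b k _ _; rewrite /sub; lra.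
Qed.

Lemma W_scal r x c : 0 < r -> W (fun a k => r * x a k) c = r * W x c.
Proof.
move=> r0; rewrite (decompW _ (decomp_scal r0 (greedyP x))) /W /wt.
by rewrite sum_mull big_map.
Qed.

Definition poslist l := [seq p <- l | ~~ Req_dec_T p.1 0].

Lemma wdecomp_decomp l x : wdecomp l x ->
  decomp (poslist l) x /\ preceq (head T (unzip2 l)) (head T (unzip2 (poslist l))).
Proof.
elim: l x => [|[w c] l IH] x /=; first by move=> H; split=> //; apply: preceq_refl.
case=> w0 ch /IH[D H]; have {}ch := prec_preceq_trans ch H.
case: Req_dec_T => /= [w00|wN].
  split; last exact: prec_preceq.
  by apply: decomp_flat D => a b k _ _; rewrite /sub w00; lra.
by split; [split=> //; lra|apply: preceq_refl].
Qed.

Lemma wt_poslist l c : wt (poslist l) c = wt l c.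
Proof.
rewrite /wt big_filter_cond [LHS]big_mkcond [RHS]big_mkcond /=.
by apply: eq_bigr => -[w e] _ /=; case: Req_dec_T => //= ->; case: ifP.
Qed.

Lemma wdecompW l x c : wdecomp l x -> W x c = wt l c.
Proof. by case/wdecomp_decomp=> D _; rewrite (decompW c D) wt_poslist. Qed.

Lemma sum_wt l (F : P' d n -> R) : \sum_(p <- l) (p.1 * F p.2) = \sum_c (wt l c * F c).
Proof.
rewrite (partition_big (fun p => p.2) predT) //=; apply: eq_bigr => c _.
by rewrite /wt sum_mulr; apply: eq_big => [//|p /eqP ->].
Qed.

Definition lc l : pt d n := fun a k => \sum_(p <- l) (p.1 * vpt p.2 a k).

(** The greedy order of subtraction leaves no trace: any positive combination of a chain below [T]
    that represents [x] modulo [flat T] is already the greedy one. *)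
Lemma decompE l x : decomp l x <->
  [/\ List.Forall (fun p => 0 < p.1) l, sorted (@prec d n) (rcons (unzip2 l) T) &
      flat T (fun a k => x a k - lc l a k)].
Proof.
elim: l x => [|[w c] l IH] x /=.
  split=> [H|[_ _ H]]; first split=> //; apply: flat_ext H => a k; rewrite /lc big_nil; lra.
have E : flat T (fun a k => sub x w c a k - lc l a k) <->
         flat T (fun a k => x a k - lc ((w, c) :: l) a k).
  by split; apply: flat_ext => a k; rewrite /sub /lc big_cons /=; lra.
have EE : path (@prec d n) c (rcons (unzip2 l) T) =
  prec c (head T (unzip2 l)) && sorted (@prec d n) (rcons (unzip2 l) T).
  by case: (l).
rewrite EE; split.
  by case=> w0 -> /IH[F -> /E ?]; split=> //; constructor.
by case=> F /andP[? ?] /E ?; inversion F; split=> //; apply/IH.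
Qed.

Lemma W_ge0 x c : 0 <= W x c.
Proof.
have /decompE[F _ _] := greedyP x; rewrite /W /wt.
elim: F => [|p l p0 _ IH]; first by rewrite big_nil; lra.
by rewrite big_cons; case: ifP => _; lra.
Qed.

Lemma wt_head w c l x : decomp ((w, c) :: l) x -> 0 < W x c.
Proof.
move=> D; rewrite (decompW c D) wt_cons eqxx /=; case: D => w0 _ D.
by have := W_ge0 (sub x w c) c; rewrite (decompW c D); lra.
Qed.

Lemma W_top x : W x T = 0.
Proof.
rewrite /W; move: (greedy x) (greedyP x) => l; elim: l x => [|[w c] l IH] x D.
  by rewrite /wt big_nil.
rewrite wt_cons; have /andP[_ /negPf -> /=] := decomp_head_top D.
by case: D => _ _ /IH ->; lra.
Qed.

Lemma flat_W x : flat T x <-> forall c, W x c = 0.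
Proof.
split=> [H c|H]; first by rewrite (decompW (l := [::]) c H) /wt big_nil.
have := greedyP x; case E : (greedy x) => [|[w c] l] // D.
by have := wt_head D; rewrite H; lra.
Qed.

Lemma W_lc x : flat T (fun a k => x a k - \sum_c (W x c * vpt c a k)).
Proof.
have /decompE[_ _] := greedyP x; apply: flat_ext => a k.
by rewrite /lc (sum_wt _ (fun c => vpt c a k)).
Qed.

Definition tot x : R := \sum_c W x c.

Lemma flat_tot x : flat T x <-> tot x = 0.
Proof.
rewrite flat_W /tot; split=> [H|H]; last exact: sum_eq0 (W_ge0 x) H.
by apply: big1 => c _; apply: H.
Qed.

Lemma tot_ge0 x : 0 <= tot x.
Proof. by apply: sum_ge0 => c _; apply: W_ge0. Qed.

Lemma tot_greedy x : tot x = \sum_(p <- greedy x) p.1.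
Proof.
transitivity (\sum_(p <- greedy x) (p.1 * 1)); last by apply: eq_bigr => p _; lra.
by rewrite (sum_wt _ (fun=> 1)); apply: eq_bigr => c _; rewrite /W; lra.
Qed.

(** For a prescribed chain the coefficients are explicit functions of [x], continuous everywhere but
    meaningful only where [s] is the right chain. *)
Fixpoint weights (s : seq (P' d n)) x : seq (R * P' d n) :=
  if s is c :: s' then (mu T c x, c) :: weights s' (sub x (mu T c x) c) else [::].

Lemma unzip2_weights s x : unzip2 (weights s x) = s.
Proof. by elim: s x => //= c s IH x; rewrite IH. Qed.

Lemma decomp_weights l x : decomp l x -> l = weights (unzip2 l) x.
Proof.
elim: l x => [|[w c] l IH] x //= D; rewrite (decomp_mu D); congr (_ :: _).
by apply: IH; case: D.
Qed.

Lemma decomp_size l x : decomp l x -> (size l <= #|P' d n|)%N.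
Proof.
case/decompE=> _ S _.
have : uniq (rcons (unzip2 l) T).
  by apply: sorted_uniq S; [apply: prec_trans|apply: prec_irr].
move/card_uniqP; rewrite size_rcons size_map => E.
by apply: leq_trans (leqnSn _) _; rewrite -E max_card.
Qed.

Section ContinuityOfWeights.
Variables (A : Type) (dA : A -> A -> R) (S : A -> Prop) (o : A).
Local Notation cvat := (cvat dA S o).
Local Notation near := (near dA S o).

Lemma cvat_foldr_min (I : Type) (r : seq I) (F : I -> A -> R) z :
  cvat z -> (forall i, cvat (F i)) ->
  cvat (fun y => foldr Rmin (z y) [seq F i y | i <- r]).
Proof. by move=> cz cF; elim: r => //= i r IH; apply: cvat_min. Qed.

Lemma cvat_mu c (X : A -> pt d n) :
  (forall a k, cvat (fun y => X y a k)) -> cvat (fun y => mu T c (X y)).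
Proof.
move=> cX; have cr t : cvat (fun y => ratio c (X y) t).
  apply: cvat_ext (cvat_scal (/ (vpt c t.1.2 t.2 - vpt c t.1.1 t.2))
    (cvat_sub (cX t.1.2 t.2) (cX t.1.1 t.2))) => y.
  by rewrite /ratio /Rdiv Rmult_comm.
rewrite /mu; apply: (@cvat_foldr_min _ _ (fun t y => ratio c (X y) t)) => //.
by case: (enum _) => [|t r]; [apply: cvat_cst|apply: cr].
Qed.

Lemma cvat_erode c (X : A -> pt d n) : (forall a k, cvat (fun y => X y a k)) ->
  forall a k, cvat (fun y => sub (X y) (mu T c (X y)) c a k).
Proof.
move=> cX a k; apply: cvat_sub => //; apply: cvat_mul; first exact: cvat_mu.
exact: cvat_cst.
Qed.

Lemma cvat_weights s c (X : A -> pt d n) :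
  (forall a k, cvat (fun y => X y a k)) -> cvat (fun y => wt (weights s (X y)) c).
Proof.
elim: s X => [|e s IH] X cX /=.
  by apply: (cvat_ext (f := fun=> 0)) (cvat_cst _ _ _ _) => y; rewrite /wt big_nil.
have H := IH (fun y => sub (X y) (mu T e (X y)) e) (cvat_erode e cX).
have [ec|ec] := boolP (e == c).
  by apply: (cvat_ext _ (cvat_add (cvat_mu e cX) H)) => y; rewrite wt_cons ec.
by apply: (cvat_ext _ H) => y; rewrite wt_cons (negPf ec) Rplus_0_l.
Qed.

(* Limits of points whose greedy chain is [s] stay in the closed cone of [s]. *)
Lemma closed_cone s (X : A -> pt d n) : (forall a k, cvat (fun y => X y a k)) ->
  wdecomp (weights s (X o)) (X o) \/ near (fun y => ~ decomp (weights s (X y)) (X y)).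
Proof.
elim: s X => [|c s IH] X cX /=.
  have [H|H] := classic (flat T (X o)); [by left|right].
  have [[[a b] k] /not_all_ex_not H'] : exists t : 'I_n * 'I_n * 'I_d,
      ~ (before T t.1.1 t.1.2 -> (t.2 < mval T t.1.1 t.1.2)%N -> X o t.1.1 t.2 = X o t.1.2 t.2).
    by apply: not_all_ex_not => H'; apply: H => a b k; apply: (H' (a, b, k)).
  have [ab H1] := H'; apply imply_to_and in H1; rewrite /= in H1; case: H1 => lt N.
  apply: near_imp (cvat_neq (cX a k) (cX b k) N) => y _ N' F; apply: N'.
  exact: F.
rewrite !unzip2_weights.
have [ch|ch] := boolP (prec c (head T s)); last first.
  by right; apply: near_true => y _; rewrite unzip2_weights (negPf ch) => -[].
have [w0|w0] := Rlt_le_dec (mu T c (X o)) 0.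
  by right; apply: near_imp (cvat_neg (cvat_mu c cX) w0) => y _ ? [? _ _]; lra.
have [H|H] := IH _ (cvat_erode c cX); first by left; split.
by right; apply: near_imp H => y _ H [_ _].
Qed.

(** Only finitely many chains occur. If the base point lies in the closed cone of [s], the
    continuous formula [weights s] takes the correct value there; otherwise no nearby point uses
    [s]. *)
Lemma cvat_W c (X : A -> pt d n) :
  (forall a k, cvat (fun y => X y a k)) -> cvat (fun y => W (X y) c).
Proof.
move=> cX eps e0; pose N := #|P' d n|.
have : near (fun y => forall s : N.-bseq (P' d n),
    decomp (weights s (X y)) (X y) ->
    Rabs (wt (weights s (X y)) c - W (X o) c) < eps).
  apply: near_all => s; have [H|H] := closed_cone s cX; last first.
    by apply: near_imp H => y _ H /H.
  rewrite (wdecompW c H).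
  by apply: near_imp (cvat_weights s c cX e0) => y _.
apply: near_imp => y _ H; have D := greedyP (X y).
have sz : (size (unzip2 (greedy (X y))) <= N)%N by rewrite size_map (decomp_size D).
have := H (Bseq sz); rewrite /= -(decomp_weights D) => /(_ D).
by [].
Qed.

End ContinuityOfWeights.
End Decomposition.

(** * Cells *)

Section Realization.
Variables (d n : nat).
Implicit Types (c : P' d n) (x : pt d n) (l : seq (R * P' d n)) (P : pred (P' d n)).

Lemma bary_lc (ws : seq R) (s : seq (P' d n)) :
  bary ws (map (@vpt d n) s) = lc (zip ws s).
Proof.
apply: functional_extensionality => a; apply: functional_extensionality => k.
rewrite /bary /lc foldr_sumE.
by elim: ws s => [|w ws IH] [|c s] /=; rewrite ?big_nil // !big_cons IH.
Qed.

Lemma zip_unzip (I J : Type) (l : seq (I * J)) : zip (unzip1 l) (unzip2 l) = l.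
Proof. by elim: l => //= -[i j] l ->. Qed.

Lemma sum_unzip1 (l : seq (R * P' d n)) : foldr Rplus 0 (unzip1 l) = \sum_(p <- l) p.1.
Proof. exact: foldr_sumE. Qed.

Lemma realizeI P l x : sorted (@prec d n) (unzip2 l) -> all P (unzip2 l) ->
  List.Forall (fun p => 0 <= p.1) l -> \sum_(p <- l) p.1 = 1 ->
  (forall a k, x a k = lc l a k) -> realize P x.
Proof.
move=> ls lP l0 l1 lx; exists (unzip2 l); split.
  by rewrite /chain ls; case: l l1 {ls lP l0 lx} => // /[!big_nil]; lra.
split=> //; exists (unzip1 l); rewrite !size_map; split=> //; split.
  exact/List.Forall_map.
split; first by rewrite sum_unzip1.
rewrite bary_lc zip_unzip.
by apply: functional_extensionality => a; apply: functional_extensionality => k.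
Qed.

Lemma sum_poslist l (F : P' d n -> R) :
  \sum_(p <- poslist l) (p.1 * F p.2) = \sum_(p <- l) (p.1 * F p.2).
Proof. by rewrite !sum_wt; apply: eq_bigr => c _; rewrite wt_poslist. Qed.

Lemma sum_wt1 l : \sum_(p <- l) p.1 = \sum_c wt l c.
Proof.
transitivity (\sum_(p <- l) (p.1 * 1)); first by apply: eq_bigr => p _; lra.
by rewrite (sum_wt _ (fun=> 1)); apply: eq_bigr => c _; lra.
Qed.

Lemma poslist_pos l :
  List.Forall (fun p => 0 <= p.1) l -> List.Forall (fun p => 0 < p.1) (poslist l).
Proof.
elim=> // -[w c] {}l /= w0 _ IH.
by case: Req_dec_T => //= N; constructor=> //=; lra.
Qed.

Lemma subseq_map_filter (I : Type) (J : eqType) (f : I -> J) (Q : pred I) (r : seq I) :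
  subseq (map f (filter Q r)) (map f r).
Proof.
elim: r => //= i r IH; case: (Q i) => /=; first by rewrite eqxx.
exact: subseq_trans IH (subseq_cons _ _).
Qed.

Lemma sub_poslist l : subseq (unzip2 (poslist l)) (unzip2 l).
Proof. exact: subseq_map_filter. Qed.

Lemma realizeE P x : realize P x -> exists l,
  [/\ sorted (@prec d n) (unzip2 l), all P (unzip2 l),
      List.Forall (fun p => 0 < p.1) l, \sum_(p <- l) p.1 = 1 &
      forall a k, x a k = lc l a k].
Proof.
case=> s [/andP[ss _] [sP [ws [sz [w0 [w1 ->]]]]]]; rewrite size_map in sz.
have E2 : unzip2 (zip ws s) = s by apply: unzip2_zip; rewrite sz.
have E1 : unzip1 (zip ws s) = ws by apply: unzip1_zip; rewrite sz.
exists (poslist (zip ws s)); split.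
- by apply: subseq_sorted ss; [apply: prec_trans|rewrite -[X in subseq _ X]E2 sub_poslist].
- apply/allP=> c /(mem_subseq (sub_poslist _)); rewrite E2; exact/allP.
- by apply: poslist_pos; rewrite -E1 in w0; apply/List.Forall_map.
- by rewrite sum_wt1 (eq_bigr _ (fun c _ => wt_poslist _ c)) -sum_wt1 -sum_unzip1 E1.
move=> a k; rewrite bary_lc /lc.
by rewrite (sum_poslist _ (fun c => vpt c a k)).
Qed.

Lemma sorted_rcons (s : seq (P' d n)) c : sorted (@prec d n) s ->
  all (fun e => prec e c) s -> sorted (@prec d n) (rcons s c).
Proof.
case: s => //= e s es /andP[ec sc]; rewrite rcons_path es /=.
by apply: (allP (_ : all (fun e => prec e c) (e :: s))); rewrite /= ?ec // mem_last.
Qed.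

Lemma sorted_rcons_all (s : seq (P' d n)) c : sorted (@prec d n) (rcons s c) ->
  sorted (@prec d n) s /\ all (fun e => prec e c) s.
Proof.
move=> S; split.
  by apply: subseq_sorted S; [apply: prec_trans|rewrite -cats1 prefix_subseq].
elim: s S => //= e s IH S; rewrite IH ?(path_sorted S) // andbT.
by have /allP := order_path_min (@prec_trans d n) S; apply; rewrite mem_rcons mem_head.
Qed.

End Realization.

(** * The cell of [T] as a gauge ball modulo [flat T] *)

Section Cell.
Variables (d n : nat) (T : P' d n).
Implicit Types (c : P' d n) (x : pt d n) (l : seq (R * P' d n)).

Lemma vpt_flat : flat T (vpt T).
Proof. by move=> a b k; apply: vpt_below. Qed.

(** The class of [x] modulo [flat T] is kept, but the coefficients are completed to sum 1: the
    difference [1 - tot T x] goes to [vpt T], which is itself flat. *)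
Definition retr x : pt d n := fun a k =>
  vpt T a k + \sum_c (W T x c * (vpt c a k - vpt T a k)).

Lemma retrE x a k :
  retr x a k = \sum_c (W T x c * vpt c a k) + (1 - tot T x) * vpt T a k.
Proof.
rewrite /retr /tot (eq_bigr (fun c => W T x c * vpt c a k - W T x c * vpt T a k)).
  by rewrite -sum_sub -sum_mulr; lra.
by move=> c _; lra.
Qed.

Lemma retr_flat x : flat T (fun a k => retr x a k - x a k).
Proof.
move=> a b k ab lt; have := @W_lc _ _ T x a b k ab lt.
by rewrite !retrE (vpt_flat ab lt) /=; lra.
Qed.

Lemma tot_cell l x : \sum_(p <- l) p.1 = 1 ->
  (forall c, c != T -> W T x c = wt l c) -> 1 - tot T x = wt l T.
Proof.
move=> <- WE; rewrite sum_wt1 /tot sum_sub (bigD1 T) //= W_top big1; first by lra.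
by move=> c cT; rewrite WE //; lra.
Qed.

(** Since [vpt T] is flat, deleting [T] from the chain of a point of the cell leaves its greedy
    decomposition relative to [T]. *)
Lemma cell_weights x : cell T x -> exists l,
  [/\ \sum_(p <- l) p.1 = 1, forall c, c != T -> W T x c = wt l c, 0 <= wt l T
      & forall a k, x a k = retr x a k].
Proof.
case/realizeE=> l [ls lT l0 l1 lx]; exists l.
pose l' := [seq p <- l | p.2 != T].
have wt' c : c != T -> wt l' c = wt l c.
  move=> cT; rewrite /wt big_filter_cond; apply: eq_bigl => p.
  by case: eqP => //= ->; rewrite eq_sym (negPf cT).
have wtT : wt l' T = 0.
  by rewrite /wt big_filter_cond big_pred0 // => p; case: eqP.
have ge0 : 0 <= wt l T.
  rewrite /wt; elim: l0 => [|p r p0 _ IH]; first by rewrite big_nil; lra.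
  by rewrite big_cons; case: ifP => _ //; lra.
have lcE a k : x a k - lc l' a k = wt l T * vpt T a k.
  rewrite lx /lc !(sum_wt _ (fun c => vpt c a k)) sum_sub (bigD1 T) //= wtT big1.
    by lra.
  by move=> c cT; rewrite wt' //; lra.
have D : decomp T l' x.
  apply/decompE; split.
  - by rewrite /l'; elim: l0 => //= p r p0 _ IH; case: ifP => // _; constructor.
  - have sub' : subseq (unzip2 l') (unzip2 l) by apply: subseq_map_filter.
    apply: sorted_rcons; first by apply: subseq_sorted ls => //; apply: prec_trans.
    apply/allP=> c cl'; rewrite /prec (allP lT) ?(mem_subseq sub') //=.
    move: cl'; rewrite /l'; elim: (l) => //= -[w e] r IH; case: ifP => //= eT.
    by rewrite inE => /predU1P[->|/IH].
  apply: (flat_ext (x := fun a k => wt l T * vpt T a k)) => // a b k ab lt.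
  by rewrite (vpt_flat ab lt).
have WE c : c != T -> W T x c = wt l c by move=> cT; rewrite (decompW c D) wt'.
split=> // a k; rewrite lx /lc (sum_wt _ (fun c => vpt c a k)) retrE (tot_cell l1 WE).
rewrite [LHS](bigD1 T) // [in RHS](bigD1 T) //= W_top.
rewrite Rmult_0_l Rplus_0_l Rplus_comm; congr (_ + _).
by apply: eq_bigr => c cT; rewrite WE.
Qed.

Lemma cell_retr x : cell T x -> x = retr x.
Proof.
case/cell_weights=> l [_ _ _ H].
by apply: functional_extensionality => a; apply: functional_extensionality => k.
Qed.

Lemma cell_tot x : cell T x -> tot T x <= 1.
Proof. by case/cell_weights=> l [l1 WE ge0 _]; have := tot_cell l1 WE; lra. Qed.

Lemma bdry_tot x : bdry T x -> tot T x = 1.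
Proof.
case/realizeE=> l [ls lT l0 l1 lx].
have D : decomp T l x.
  apply/decompE; split=> //; first exact: sorted_rcons.
  by move=> a b k _ _; rewrite !lx; lra.
rewrite /tot -l1 sum_wt1; apply: eq_bigr => c _; exact: decompW.
Qed.

Lemma retr_cell x : tot T x <= 1 -> cell T (retr x).
Proof.
move=> t1; have /decompE[l0 ls _] := greedyP T x.
have [ls' lT] := sorted_rcons_all ls.
apply: (@realizeI _ _ _ (rcons (greedy T x) (1 - tot T x, T))).
- by rewrite /unzip2 map_rcons.
- rewrite /unzip2 map_rcons all_rcons preceq_refl /=.
  by apply: sub_all lT => c /prec_preceq.
- rewrite -cats1; apply/List.Forall_app; split; last by constructor=> //=; lra.
  by apply: List.Forall_impl l0 => p; lra.
- by rewrite -cats1 big_cat big_seq1 /= -tot_greedy; lra.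
by move=> a k; rewrite retrE /lc -cats1 big_cat big_seq1 /= (sum_wt _ (fun c => vpt c a k)).
Qed.

Lemma retr_bdry x : tot T x = 1 -> bdry T (retr x).
Proof.
move=> t1; have /decompE[l0 ls _] := greedyP T x.
have [ls' lT] := sorted_rcons_all ls.
apply: (@realizeI _ _ _ (greedy T x)) => //.
- by apply: List.Forall_impl l0 => p; lra.
- by rewrite -tot_greedy.
by move=> a k; rewrite retrE /lc (sum_wt _ (fun c => vpt c a k)) t1 /W; lra.
Qed.

Lemma tot_flat x y : flat T (fun a k => x a k - y a k) -> tot T x = tot T y.
Proof. by move=> H; apply: eq_bigr => c _; apply: W_flat. Qed.

Lemma tot_scal r x : 0 < r -> tot T (fun a k => r * x a k) = r * tot T x.
Proof. by move=> r0; rewrite /tot sum_mull; apply: eq_bigr => c _; apply: W_scal. Qed.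

Lemma W_le_tot x c : W T x c <= tot T x.
Proof. exact: (@sum_ge_term _ (W T x) c (W_ge0 T x)). Qed.

End Cell.

(** * Cells as balls *)

Section Metrics.

Lemma distkE k (y z : 'I_k -> R) : distk y z = \sum_l Rabs (y l - z l).
Proof. exact: rsumE. Qed.

Lemma distE d n (x y : pt d n) : dist x y = \sum_j \sum_k Rabs (x j k - y j k).
Proof. by rewrite /dist rsumE; apply: eq_bigr => j _; rewrite rsumE. Qed.

Lemma distk_coord k (y z : 'I_k -> R) l : Rabs (y l - z l) <= distk y z.
Proof.
rewrite distkE.
exact: (@sum_ge_term _ (fun l => Rabs (y l - z l)) l (fun _ => Rabs_pos _)).
Qed.

Lemma dist_coord d n (x y : pt d n) j k : Rabs (x j k - y j k) <= dist x y.
Proof.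
have H1 := @sum_ge_term _ (fun k => Rabs (x j k - y j k)) k (fun _ => Rabs_pos _).
have H2 := @sum_ge_term _ (fun j => \sum_k Rabs (x j k - y j k)) j
   (fun j => sum_ge0 _ (fun _ _ => Rabs_pos _)).
by rewrite distE; apply: Rle_trans H1 H2.
Qed.

Variables (A : Type) (dA : A -> A -> R) (S : A -> Prop).

Lemma cvat_dominated x (f : A -> R) :
  (forall y, Rabs (f x - f y) <= dA x y) -> cvat dA S x f.
Proof.
move=> H e e0; exists e; split=> // y _ lt.
by rewrite Rabs_minus_sym; apply: Rle_lt_trans (H y) lt.
Qed.

Lemma cvat_dist0 x (f : A -> R) : cvat dA S x f -> cvat dA S x (fun y => Rabs (f x - f y)).
Proof.
move=> cf; apply: (cvat_comp (g := Rabs)); first exact: Rcontinuity_abs.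
by apply: cvat_sub => //; apply: cvat_cst.
Qed.

Lemma cont_onP d n (f : A -> pt d n) :
  (forall x, S x -> forall j k, cvat dA S x (fun y => f y j k)) ->
  cont_on dA (@dist d n) S f.
Proof.
move=> H x Sx e e0.
have : cvat dA S x (fun y => dist (f x) (f y)).
  apply: (cvat_ext (f := fun y => \sum_j \sum_k Rabs (f x j k - f y j k))).
    by move=> y; rewrite distE.
  by do 2 apply: cvat_sum => ?; apply: (cvat_dist0 (H x Sx _ _)).
case/(_ e e0)=> r [r0 rP]; exists r; split=> // y Sy /(rP y Sy).
have -> : dist (f x) (f x) = 0.
  by rewrite distE !big1 // => j _; rewrite big1 // => k _; rewrite Rminus_diag Rabs_R0.
by rewrite Rminus_0_r => /(Rle_lt_trans _ _ _ (Rle_abs _)).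
Qed.

Lemma cont_onPk k (f : A -> 'I_k -> R) :
  (forall x, S x -> forall l, cvat dA S x (fun y => f y l)) ->
  cont_on dA (@distk k) S f.
Proof.
move=> H x Sx e e0.
have : cvat dA S x (fun y => distk (f x) (f y)).
  apply: (cvat_ext (f := fun y => \sum_l Rabs (f x l - f y l))).
    by move=> y; rewrite distkE.
  by apply: cvat_sum => ?; apply: (cvat_dist0 (H x Sx _)).
case/(_ e e0)=> r [r0 rP]; exists r; split=> // y Sy /(rP y Sy).
have -> : distk (f x) (f x) = 0.
  by rewrite distkE big1 // => l _; rewrite Rminus_diag Rabs_R0.
by rewrite Rminus_0_r => /(Rle_lt_trans _ _ _ (Rle_abs _)).
Qed.

End Metrics.

Section Norm.
Variable m : nat.
Implicit Types y z : 'I_m -> R.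

Definition nrm y : R := sqrt (\sum_l (y l * y l)).

Lemma nrm_sum_ge0 y : 0 <= \sum_l (y l * y l).
Proof. by apply: sum_ge0 => l _; nra. Qed.

Lemma nrm_ge0 y : 0 <= nrm y.
Proof. exact: sqrt_pos. Qed.

Lemma nrm_sqr y : nrm y * nrm y = \sum_l (y l * y l).
Proof. exact/sqrt_sqrt/nrm_sum_ge0. Qed.

Lemma nrm_coord y l : Rabs (y l) <= nrm y.
Proof.
rewrite -sqrt_Rsqr_abs; apply: sqrt_le_1_alt.
by apply: (@sum_ge_term _ (fun l => y l * y l) l) => i; nra.
Qed.

Lemma nrm_eq0 y : nrm y = 0 -> forall l, y l = 0.
Proof.
move=> y0 l; have := nrm_coord y l; rewrite y0 => le.
by apply: NNPP => /Rabs_pos_lt; lra.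
Qed.

Lemma nrm_scal r y : 0 <= r -> nrm (fun l => r * y l) = r * nrm y.
Proof.
move=> r0; rewrite -[X in X * nrm y](sqrt_square r) // -sqrt_mult_alt; last by nra.
rewrite /nrm sum_mull; congr sqrt; apply: eq_bigr => l _; lra.
Qed.

Lemma nrm0 y : (forall l, y l = 0) -> nrm y = 0.
Proof.
move=> y0; rewrite /nrm (eq_bigr (fun=> 0)) => [|l _]; last by rewrite y0; lra.
by rewrite big1_eq sqrt_0.
Qed.

Lemma ballk_nrm y : ballk y <-> nrm y <= 1.
Proof.
rewrite /ballk rsumE -nrm_sqr; have := nrm_ge0 y.
by split=> ?; nra.
Qed.

Lemma spherek_nrm y : spherek y <-> nrm y = 1.
Proof.
rewrite /spherek rsumE -nrm_sqr; have := nrm_ge0 y.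
by split=> [?|->]; nra.
Qed.

Lemma cvat_nrm (A : Type) (dA : A -> A -> R) S a (Y : A -> 'I_m -> R) :
  (forall l, cvat dA S a (fun u => Y u l)) -> cvat dA S a (fun u => nrm (Y u)).
Proof.
move=> cY; apply: (cvat_comp (g := sqrt) (f := fun u => \sum_l (Y u l * Y u l))).
  exact/continuity_pt_sqrt/nrm_sum_ge0.
by apply: cvat_sum => l; apply: cvat_mul.
Qed.

End Norm.

(** * Polar coordinates on the quotient by [flat T] *)

Section Slice.
Variables (d n : nat) (T : P' d n) (m : nat) (e : 'I_m -> 'I_n.-1 * 'I_d).
Hypothesis e_inj : injective e.
Hypothesis e_slice : forall l, ((e l).2 < T.2 (e l).1)%N.
Hypothesis e_onto : forall (j : 'I_n.-1) (k : 'I_d), (k < T.2 j)%N -> exists l, e l = (j, k).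
Implicit Types (x : pt d n) (y z : 'I_m -> R).

(** Linear coordinates on the quotient: [e] lists the pairs of a step of [T] and a coordinate below
    its level, and flatness means that these differences of neighbouring columns vanish. *)
Definition proj x l : R :=
  x (rletter T (e l).1) (e l).2 - x (lletter T (e l).1) (e l).2.

(** A linear section of [proj], obtained by adding up the prescribed differences along the order of
    [T]. *)
Definition lift y : pt d n := fun a k =>
  \sum_(l | ((e l).1 < pos T.1 a)%N && ((e l).2 == k)) y l.

Lemma proj_lift y l : proj (lift y) l = y l.
Proof.
rewrite /proj /lift pos_lletter pos_rletter.
rewrite [X in X - _]big_mkcond [X in _ - X]big_mkcond sum_sub /=.
rewrite (bigD1 l) //= eqxx ltnn ltnSn /= big1; first by lra.
move=> i il; have [E2|_] := eqVneq (e i).2 (e l).2; rewrite ?andbF ?andbT; last by lra.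
have N : (e i).1 != (e l).1 :> nat.
  apply: contra_neq il => /val_inj E1; apply: e_inj.
  by case: (e i) (e l) E1 E2 => [? ?] [? ?] /= -> ->.
by rewrite ltnS leq_eqVlt (negPf N) /=; case: ifP; lra.
Qed.

Lemma flat_proj x : flat T x <-> forall l, proj x l = 0.
Proof.
split=> [H l|H a b k ab km].
  rewrite /proj (H _ _ _ (before_letters T (e l).1)) ?mval_letters //; lra.
(* Walk from [a] to [b] through neighbouring letters; all levels on the way are above [k], so each
   step is covered by [e]. *)
have main q : forall b, pos T.1 b = (pos T.1 a + q)%N ->
    (forall j : 'I_n.-1, (pos T.1 a <= j < pos T.1 b)%N -> (k < T.2 j)%N) -> x a k = x b k.
  elim: q => [|q IH] f E Hf; first by have -> // := @pos_inj _ _ T f a; rewrite E addn0.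
  have jn : (pos T.1 a + q < n.-1)%N by have := pos_lt T f; lia.
  have ff : f = rletter T (Ordinal jn).
    by apply: (@pos_inj _ _ T); rewrite pos_rletter E addnS.
  have [l le] : exists l, e l = (Ordinal jn, k).
    by apply: e_onto; apply: Hf; rewrite E /= leq_addr addnS ltnSn.
  have := H l; rewrite /proj le /= -ff => /Rminus_diag_uniq ->.
  apply: IH; first by rewrite pos_lletter.
  by move=> j; rewrite pos_lletter /= => /andP[aj jq]; apply: Hf; rewrite E aj addnS leqW.
apply: (main (pos T.1 b - pos T.1 a)%N); first by move: ab; rewrite /before; lia.
by move=> j jP; apply: leq_trans km (mval_le jP).
Qed.

Lemma flat_lift x : flat T (fun a k => lift (proj x) a k - x a k).
Proof.
apply/flat_proj=> l; have := proj_lift (proj x) l; rewrite /proj; lra.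
Qed.

Lemma flat_liftE y : flat T (lift y) <-> nrm y = 0.
Proof.
rewrite flat_proj; split=> [H|/nrm_eq0 H l]; last by rewrite proj_lift.
by apply: nrm0 => l; rewrite -proj_lift.
Qed.

Lemma flat_nrm x : flat T x <-> nrm (proj x) = 0.
Proof. by rewrite flat_proj; split=> [/nrm0|/nrm_eq0]. Qed.

Lemma lift_scal r y a k : lift (fun l => r * y l) a k = r * lift y a k.
Proof. by rewrite /lift sum_mull. Qed.

(** The direction of [z] is kept and its gauge becomes [nrm z]. The formula is written with the
    quotients of [W] by [tot] because these stay between 0 and 1, which gives continuity at the
    centre. *)
Definition of_ball z : pt d n := fun a k =>
  vpt T a k + \sum_c (nrm z * (W T (lift z) c / tot T (lift z)) * (vpt c a k - vpt T a k)).

Definition to_ball x : 'I_m -> R := fun l => tot T x * (proj x l / nrm (proj x)).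

Lemma of_ball_retr z : exists r, [/\ 0 <= r, nrm z <> 0 -> 0 < r,
  of_ball z = retr T (fun a k => r * lift z a k) &
  tot T (fun a k => r * lift z a k) = nrm z].
Proof.
have [z0|zN] := Req_dec_T (nrm z) 0.
  exists 0.
  have H : flat T (fun a k => 0 * lift z a k) by move=> a b k _ _; lra.
  split; [lra| by [] | |by rewrite z0; apply/flat_tot].
  apply: functional_extensionality => a; apply: functional_extensionality => k.
  rewrite /of_ball /retr; congr (_ + _); apply: eq_bigr => c _.
  by have /flat_W -> := H; rewrite z0; lra.
have tN : tot T (lift z) <> 0 by move/flat_tot/flat_liftE.
have t0 : 0 < tot T (lift z) by have := tot_ge0 T (lift z); lra.
have n0 : 0 < nrm z by have := nrm_ge0 z; lra.
have r0 : 0 < nrm z / tot T (lift z) by apply: Rdiv_lt_0_compat.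
exists (nrm z / tot T (lift z)); split=> //; first lra.
  apply: functional_extensionality => a; apply: functional_extensionality => k.
  rewrite /of_ball /retr; congr (_ + _); apply: eq_bigr => c _.
  by rewrite W_scal //; congr (_ * _); field.
by rewrite tot_scal //; field.
Qed.

Lemma tot_retr x : tot T (retr T x) = tot T x.
Proof. exact/tot_flat/retr_flat. Qed.

Lemma proj_flat x x' l : flat T (fun a k => x a k - x' a k) -> proj x l = proj x' l.
Proof. by move/flat_proj/(_ l); rewrite /proj; lra. Qed.

Lemma of_ballK z : to_ball (of_ball z) = z.
Proof.
have [r [r0 rN E Et]] := of_ball_retr z.
apply: functional_extensionality => l; rewrite /to_ball E tot_retr Et.
have pE i : proj (retr T (fun a k => r * lift z a k)) i = r * z i.
  rewrite (proj_flat i (@retr_flat _ _ T (fun a k => r * lift z a k))).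
  by rewrite -[in RHS](proj_lift z) /proj; lra.
have -> : proj (retr T (fun a k => r * lift z a k)) = (fun i => r * z i).
  exact: functional_extensionality.
rewrite nrm_scal //; have [z0|zN] := Req_dec_T (nrm z) 0.
  by rewrite z0 (nrm_eq0 z0); lra.
by field; split=> //; have := rN zN; lra.
Qed.

Lemma nrm_to_ball x : nrm (to_ball x) = tot T x.
Proof.
have [p0|pN] := Req_dec_T (nrm (proj x)) 0.
  have -> : tot T x = 0 by apply/flat_tot/flat_nrm.
  by apply: nrm0 => l; rewrite /to_ball (nrm_eq0 p0); lra.
have n0 : 0 < nrm (proj x) by have := nrm_ge0 (proj x); lra.
have -> : to_ball x = fun l => (tot T x / nrm (proj x)) * proj x l.
  by apply: functional_extensionality => l; rewrite /to_ball; field.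
rewrite nrm_scal; first by field.
by apply: Rle_mult_inv_pos => //; apply: tot_ge0.
Qed.

Lemma to_ballK x : cell T x -> of_ball (to_ball x) = x.
Proof.
move=> /cell_retr xE; rewrite [RHS]xE.
apply: functional_extensionality => a; apply: functional_extensionality => k.
rewrite /of_ball /retr nrm_to_ball; congr (_ + _); apply: eq_bigr => c _.
congr (_ * _).
have [t0|tN] := Req_dec_T (tot T x) 0.
  by rewrite t0 (sum_eq0 (W_ge0 T x) t0); lra.
have t0 : 0 < tot T x by have := tot_ge0 T x; lra.
have pN : nrm (proj x) <> 0 by move/flat_nrm/flat_tot.
have n0 : 0 < nrm (proj x) by have := nrm_ge0 (proj x); lra.
pose r := tot T x / nrm (proj x).
have r0 : 0 < r by apply: Rdiv_lt_0_compat.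
(* The lift is a positive multiple of [x] modulo [flat T]; since [W] and [tot] are homogeneous,
   their quotient does not change. *)
have F : flat T (fun a k => lift (to_ball x) a k - r * x a k).
  have -> : to_ball x = fun l => r * proj x l.
    by apply: functional_extensionality => l; rewrite /to_ball /r; field.
  move=> a' b' k' ab lt; have := @flat_lift x _ _ _ ab lt; rewrite !lift_scal; nra.
rewrite (W_flat c F) (tot_flat F) W_scal // tot_scal //.
by field; split=> //; lra.
Qed.

Lemma of_ball_cell z : ballk z -> cell T (of_ball z).
Proof.
have [r [_ _ -> E]] := of_ball_retr z; rewrite ballk_nrm -E; exact: retr_cell.
Qed.

Lemma of_ball_tot z : tot T (of_ball z) = nrm z.
Proof. by have [r [_ _ -> <-]] := of_ball_retr z; rewrite tot_retr. Qed.

Lemma of_ball_bdry z : spherek z <-> bdry T (of_ball z).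
Proof.
rewrite spherek_nrm -of_ball_tot; split; last exact: bdry_tot.
by have [r [_ _ -> E]] := of_ball_retr z; rewrite tot_retr; apply: retr_bdry.
Qed.

Section Continuity.
Variables (A : Type) (dA : A -> A -> R) (S : A -> Prop) (o : A).

Lemma cvat_tot (X : A -> pt d n) : (forall a k, cvat dA S o (fun u => X u a k)) ->
  cvat dA S o (fun u => tot T (X u)).
Proof. by move=> cX; apply: cvat_sum => c; apply: cvat_W. Qed.

Lemma cvat_of_ball (Z : A -> 'I_m -> R) : (forall l, cvat dA S o (fun u => Z u l)) ->
  forall a k, cvat dA S o (fun u => of_ball (Z u) a k).
Proof.
move=> cZ a k; have cn := cvat_nrm cZ.
have cl b i : cvat dA S o (fun u => lift (Z u) b i) by apply: cvat_sum.
apply: cvat_add; first exact: cvat_cst.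
apply: cvat_sum => c; apply: cvat_mul; last exact: cvat_cst.
have [z0|zN] := Req_dec_T (nrm (Z o)) 0; last first.
  apply: cvat_mul => //; apply: cvat_div; last exact: cvat_tot.
    by move/flat_tot/flat_liftE.
  exact: cvat_W.
apply: (cvat_zero cn) => //; first by rewrite z0; lra.
move=> u; set t := tot T _; set w := W _ _ _.
have w0 : 0 <= w by apply: W_ge0.
have wt : w <= t by apply: W_le_tot.
have n0 := nrm_ge0 (Z u).
have [t0|tN] := Req_dec_T t 0.
  by rewrite t0 /Rdiv Rinv_0 !Rmult_0_r Rabs_R0.
have [q0 q1] : 0 <= w / t /\ w / t <= 1.
  have tp : 0 < t by lra.
  split; first exact: Rle_mult_inv_pos.
  by apply: (Rmult_le_reg_r t) => //; rewrite /Rdiv Rmult_assoc Rinv_l //; lra.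
by rewrite Rabs_pos_eq; nra.
Qed.

Lemma cvat_to_ball (X : A -> pt d n) : (forall a k, cvat dA S o (fun u => X u a k)) ->
  forall l, cvat dA S o (fun u => to_ball (X u) l).
Proof.
move=> cX l; have ct := cvat_tot cX.
have cp i : cvat dA S o (fun u => proj (X u) i) by apply: cvat_sub.
have [p0|pN] := Req_dec_T (nrm (proj (X o))) 0; last first.
  by apply: cvat_mul => //; apply: cvat_div => //; apply: cvat_nrm.
have t0 : tot T (X o) = 0 by apply/flat_tot/flat_nrm.
apply: (cvat_zero ct) => //; first by rewrite /to_ball t0; lra.
by move=> u; apply: Rle_trans (nrm_coord _ l) _; rewrite nrm_to_ball; lra.
Qed.

End Continuity.

Lemma slice_homeo : exists (h : ('I_m -> R) -> pt d n) (g : pt d n -> ('I_m -> R)),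
  cont_on (@distk m) (@dist d n) (@ballk m) h /\
  cont_on (@dist d n) (@distk m) (cell T) g /\
  (forall y, ballk y -> cell T (h y) /\ g (h y) = y) /\
  (forall x, cell T x -> ballk (g x) /\ h (g x) = x) /\
  (forall y, ballk y -> (spherek y <-> bdry T (h y))).
Proof.
exists of_ball, to_ball; split.
  apply: cont_onP => z _; apply: cvat_of_ball => l; apply: cvat_dominated => y.
  exact: distk_coord.
split.
  apply: cont_onPk => x _; apply: cvat_to_ball => a k; apply: cvat_dominated => y.
  exact: dist_coord.
split; first by move=> y by_; split; [apply: of_ball_cell|apply: of_ballK].
split; last by move=> y _; apply: of_ball_bdry.
by move=> x xT; split; [apply/ballk_nrm; rewrite nrm_to_ball; apply: cell_tot|apply: to_ballK].
Qed.

End Slice.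

Lemma cell_homeo d n (T : P' d n) :
  exists (h : ('I_(dimP T) -> R) -> pt d n) (g : pt d n -> ('I_(dimP T) -> R)),
  cont_on (@distk (dimP T)) (@dist d n) (@ballk (dimP T)) h /\
  cont_on (@dist d n) (@distk (dimP T)) (cell T) g /\
  (forall y, ballk y -> cell T (h y) /\ g (h y) = y) /\
  (forall x, cell T x -> ballk (g x) /\ h (g x) = x) /\
  (forall y, ballk y -> (spherek y <-> bdry T (h y))).
Proof.
pose A := [pred q : 'I_n.-1 * 'I_d | (q.2 < T.2 q.1)%N].
(* Levels are stored from 0, so the level of a step is the number of coordinates below it. *)
have dimA : dimP T = #|A|.
  rewrite /dimP -sum1_card (eq_bigl (fun q : 'I_n.-1 * 'I_d => true && (q.2 < T.2 q.1)%N)) //.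
  rewrite -(pair_big_dep predT (fun j (k : 'I_d) => (k < T.2 j)%N) (fun _ _ => 1%N)) /=.
  apply: eq_bigr => j _; rewrite sum1dep_card.
  rewrite -[LHS]card_ord -(card_image (f := widen_ord (ltnW (ltn_ord (T.2 j))))); last first.
    by move=> i i' /(congr1 val) /= /val_inj.
  apply: eq_card => k; rewrite !inE; apply/imageP/idP => [[i _ ->] //=|lt].
  by exists (Ordinal lt) => //; apply: val_inj.
rewrite dimA; apply: (@slice_homeo d n T #|A| (@enum_val _ A)).
- exact: enum_val_inj.
- by move=> l; have := enum_valP l.
- move=> j k lt; have jkA : (j, k) \in A by [].
  by exists (enum_rank_in jkA (j, k)); rewrite enum_rankK_in.
Qed.

(** * The action of the symmetric group *)

Section Symmetry.
Variables (d n : nat) (pi : {perm 'I_n}).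
Implicit Types (c : P' d n) (a b : 'I_n).

Lemma pos_act c a : pos (act_P pi c).1 a = pos c.1 ((pi^-1)%g a).
Proof. by rewrite /pos /= invMg permM. Qed.

Lemma before_act c a b :
  before (act_P pi c) a b = before c ((pi^-1)%g a) ((pi^-1)%g b).
Proof. by rewrite /before !pos_act. Qed.

Lemma mval_act c a b : mval (act_P pi c) a b = mval c ((pi^-1)%g a) ((pi^-1)%g b).
Proof. by rewrite /mval !pos_act. Qed.

Lemma vtilde_act c a k : vtilde (act_P pi c) a k = vtilde c ((pi^-1)%g a) k.
Proof.
by rewrite /vtilde; congr INR; apply: eq_card => j; rewrite !inE -!pos_act.
Qed.

Lemma vpt_act c : vpt (act_P pi c) = act_pt pi (vpt c).
Proof.
apply: functional_extensionality => a; apply: functional_extensionality => k.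
rewrite /act_pt /vpt vtilde_act; congr (_ - _ * _); rewrite !rsumE.
rewrite (reindex_inj (@perm_inj _ pi)) /=; apply: eq_bigr => b _.
by rewrite vtilde_act permK.
Qed.

Lemma preceq_act c c' : preceq (act_P pi c) (act_P pi c') = preceq c c'.
Proof.
apply/preceqP/preceqP=> H a b ab.
  have := H (pi a) (pi b); rewrite !before_act !mval_act !permK; exact.
by move: ab; rewrite !before_act !mval_act; apply: H.
Qed.

Lemma act_P_inj : injective (@act_P d n pi).
Proof. by move=> [s f] [s' f'] [/mulIg -> ->]. Qed.

Lemma prec_act c c' : prec (act_P pi c) (act_P pi c') = prec c c'.
Proof. by rewrite /prec preceq_act (inj_eq act_P_inj). Qed.

Lemma cell_act c x : cell c x -> cell (act_P pi c) (act_pt pi x).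
Proof.
case=> s [/andP[ss s0] [sP [ws [sz [w0 [w1 ->]]]]]].
exists (map (act_P pi) s); split.
  rewrite /chain (mono_sorted prec_act) ss /=.
  by case: s s0 {ss sP sz}.
split.
  by rewrite all_map; apply: sub_all sP => e /=; rewrite preceq_act.
exists ws; rewrite !size_map in sz *; split=> //; split=> //; split=> //.
apply: functional_extensionality => a; apply: functional_extensionality => k.
rewrite {1}/act_pt /bary; congr foldr.
elim: ws s {w0 w1 ss s0 sP sz} => [|w ws IH] [|e s] //=.
by rewrite IH vpt_act.
Qed.

End Symmetry.

(** * The deformation retraction *)

Section AddedLevel.
Variables (d n : nat).
Hypothesis n_gt1 : (1 < n)%N.
Implicit Types (c : P' d n) (x : pt d n) (m : seq (R * P' d n)).

(* Every stratum of the whole of R^(d x n), collisions included, becomes an element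
   below [top] in one more level: columns that agree in all [d] coordinates are
   separated at level [d] in the order of their indices. *)
Definition top : P' d.+1 n := (1%g, [ffun=> ord_max]).
Definition inc c : P' d.+1 n := (c.1, [ffun j => widen_ord (leqnSn d) (c.2 j)]).
(** The value 0 is arbitrary: [top] separates every pair at level [d], so relative to [top] the new
    coordinate is invisible. *)
Definition ext x : pt d.+1 n := fun a k => if insub (k : nat) is Some i then x a i else 0.

Lemma ext_widen x a k : ext x a (widen_ord (leqnSn d) k) = x a k.
Proof. by rewrite /ext /= valK. Qed.

Lemma widenP (k : 'I_d.+1) : (k < d)%N -> exists i : 'I_d, k = widen_ord (leqnSn d) i.
Proof. by move=> kd; exists (Ordinal kd); apply: val_inj. Qed.

Lemma mval_inc c a b : a != b -> mval (inc c) a b = mval c a b.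
Proof.
wlog ab : a b / before c a b.
  move=> H N; have [ab|ba] := before_total c N; first exact: H.
  by rewrite mval_sym (mval_sym c); apply: H => //; rewrite eq_sym.
move=> _; apply/eqP; rewrite eqn_leq; apply/andP; split.
  have [j jP <-] := mval_attained ab.
  by have := @mval_le _ _ (inc c) a b j jP; rewrite /= ffunE.
have [j jP <-] := @mval_attained _ _ (inc c) a b ab.
by rewrite /= ffunE; apply: mval_le.
Qed.

Lemma mval_top a b : a != b -> mval top a b = d.
Proof.
move=> N; have [ab|ab] := before_total top N; last rewrite mval_sym;
by have [j _ <-] := mval_attained ab; rewrite /= ffunE.
Qed.

Lemma preceq_inc c c' : preceq (inc c) (inc c') = preceq c c'.
Proof.
by apply/preceqP/preceqP=> H a b ab; have := H a b ab; rewrite !(mval_inc _ (before_neq ab)).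
Qed.

Lemma inc_inj : injective inc.
Proof.
move=> [s f] [s' f'] [-> /ffunP E]; congr (_, _); apply/ffunP=> j.
by have := E j; rewrite !ffunE => /(congr1 val) /= /val_inj.
Qed.

Lemma prec_inc c c' : prec (inc c) (inc c') = prec c c'.
Proof. by rewrite /prec preceq_inc (inj_eq inc_inj). Qed.

Lemma inc_top c : prec (inc c) top.
Proof.
apply/andP; split.
  apply/preceqP=> a b ab; have N := before_neq ab; rewrite mval_top // mval_inc //.
  have [cab|cba] := before_total c N; [left|right]; split=> //.
    by rewrite ltnW // mval_lt.
  by rewrite mval_sym mval_lt.
have j0 : 'I_n.-1 by apply: (@Ordinal _ 0); lia.
apply/eqP=> -[_ /ffunP/(_ j0)]; rewrite !ffunE => /(congr1 val) /= E.
by have := ltn_ord (c.2 j0); rewrite E ltnn.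
Qed.

Lemma vtilde_inc c a k : vtilde (inc c) a (widen_ord (leqnSn d) k) = vtilde c a k.
Proof. by rewrite /vtilde; congr INR; apply: eq_card => j; rewrite !inE /= ffunE. Qed.

Lemma vpt_inc c a k : vpt (inc c) a (widen_ord (leqnSn d) k) = vpt c a k.
Proof.
rewrite /vpt vtilde_inc; congr (_ - _ * _); rewrite !rsumE.
by apply: eq_bigr => b _; rewrite vtilde_inc.
Qed.

Lemma flat_top (z : pt d.+1 n) :
  (forall a b k, z a (widen_ord (leqnSn d) k) = z b (widen_ord (leqnSn d) k)) -> flat top z.
Proof.
by move=> H a b k ab; rewrite mval_top ?(before_neq ab) // => /widenP[i ->].
Qed.

Lemma strat_config x c : strat top (ext x) (inc c) -> config_space x.
Proof.
case=> _ H a b /eqP N.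
wlog ab : a b N / before c a b.
  move=> W; have [|ba] := before_total c N; first exact: W.
  by apply: not_eq_sym; apply: W => //; rewrite eq_sym.
pose k := Ordinal (mval_lt ab).
have [_] := H a b ab (widen_ord (leqnSn d) k); rewrite !ext_widen mval_inc // mval_top //=.
by move=> /(_ erefl (mval_lt ab)) lt E; move: lt; rewrite E; lra.
Qed.

Definition low (c : P' d.+1 n) := [forall j, (c.2 j < d)%N].

Lemma low_inc c : low (inc c).
Proof. by apply/forallP=> j; rewrite /= ffunE /=. Qed.

Lemma lowP (c : P' d.+1 n) : low c -> exists c', c = inc c'.
Proof.
move/forallP=> H; case: c H => s f /= H.
have [g gP] : exists g : 'I_n.-1 -> 'I_d, forall j, f j = widen_ord (leqnSn d) (g j).
  by apply: (@fin_all_exists _ (fun=> 'I_d) (fun j k => f j = widen_ord (leqnSn d) k)) => j;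
     apply: widenP.
by exists (s, [ffun j => g j]); congr (_, _); apply/ffunP=> j; rewrite !ffunE.
Qed.

(** Going down only lowers [mval], hence the levels of the steps. The low strings, those of
    collision-free strata, thus come first in every chain. *)
Lemma low_down (c c' : P' d.+1 n) : preceq c c' -> low c' -> low c.
Proof.
move=> cc' /lowP[e E]; subst c'; apply/forallP=> j; rewrite -mval_letters.
have N := before_neq (before_letters c j).
apply: leq_ltn_trans (preceq_mval _ _ cc') _; rewrite mval_inc //.
have [H|H] := before_total e N; first exact: mval_lt.
by rewrite mval_sym; apply: mval_lt.
Qed.

(** A step of level [d] would make two neighbouring columns agree in all [d] coordinates. *)
Lemma config_strat x : config_space x -> exists c, strat top (ext x) (inc c).
Proof.
move=> xF; have [c xc] := strat_exists top (ext x).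
suff /lowP[c' E] : low c by exists c'; rewrite -E.
apply/forallP=> j; rewrite ltnNge; apply/negP=> dj.
have N := before_neq (before_letters c j).
case: (xF _ _ (elimN eqP N)); apply: functional_extensionality => k.
case: xc => _ /(_ _ _ (before_letters c j) (widen_ord (leqnSn d) k)) [].
rewrite !ext_widen mval_letters => -> //=; exact: leq_trans (ltn_ord k) dj.
Qed.

Definition mapinc m := [seq (p.1, inc p.2) | p <- m].

Lemma unzip2_mapinc m : unzip2 (mapinc m) = map inc (unzip2 m).
Proof. by rewrite /unzip2 -!map_comp. Qed.

Lemma mapinc_inj : injective mapinc.
Proof.
apply: inj_map => -[w c] [w' c'] E.
by congr (_, _); [apply: (congr1 fst E)|apply: inc_inj (congr1 snd E)].
Qed.

Lemma lc_mapinc m a k : lc (mapinc m) a (widen_ord (leqnSn d) k) = lc m a k.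
Proof. by rewrite /lc big_map /=; apply: eq_bigr => p _; rewrite vpt_inc. Qed.

Lemma wt_mapinc m c : wt (mapinc m) (inc c) = wt m c.
Proof. by rewrite /wt big_map; apply: eq_bigl => p /=; rewrite (inj_eq inc_inj). Qed.

Lemma decomp_mapinc m x : List.Forall (fun p => 0 < p.1) m ->
  sorted (@prec d n) (unzip2 m) -> (forall a k, x a k = lc m a k) ->
  decomp top (mapinc m) (ext x).
Proof.
move=> m0 ms mx; apply/decompE; split; first exact/List.Forall_map.
  rewrite unzip2_mapinc; apply: sorted_rcons; first by rewrite (mono_sorted prec_inc).
  by apply/allP=> c /mapP[e _ ->]; apply: inc_top.
by apply: flat_top => a b k; rewrite !ext_widen !lc_mapinc !mx; lra.
Qed.

(** Uniqueness of barycentric coordinates is uniqueness of the greedy decomposition relative to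
    [top]. *)
Lemma lc_uniq m m' :
  List.Forall (fun p => 0 < p.1) m -> sorted (@prec d n) (unzip2 m) ->
  List.Forall (fun p => 0 < p.1) m' -> sorted (@prec d n) (unzip2 m') ->
  (forall a k, lc m a k = lc m' a k) -> m = m'.
Proof.
move=> m0 ms m'0 m's E; apply: mapinc_inj.
by apply: (decomp_uniq (decomp_mapinc m0 ms (fun _ _ => erefl)) (decomp_mapinc m'0 m's E)).
Qed.

Lemma low_list (l : seq (R * P' d.+1 n)) : all low (unzip2 l) -> exists m, l = mapinc m.
Proof.
elim: l => [|[w c] l IH] /=; first by exists [::].
by case/andP=> /lowP[e ->] /IH[m ->]; exists ((w, e) :: m).
Qed.

Definition lowpart (l : seq (R * P' d.+1 n)) := [seq p <- l | low p.2].

Lemma lowpart_mapinc l : exists m, lowpart l = mapinc m.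
Proof.
by apply: low_list; elim: l => //= -[w c] l IH /=; case: ifP => //= ->.
Qed.

Lemma wt_lowpart l c : wt (lowpart l) (inc c) = wt l (inc c).
Proof.
rewrite /wt big_filter_cond; apply: eq_bigl => p.
by case: eqP => [->|_]; rewrite ?low_inc ?andbF.
Qed.

Definition weight x c : R := W top (ext x) (inc c).
Definition total x : R := \sum_c weight x c.

Lemma weight_ge0 x c : 0 <= weight x c. Proof. exact: W_ge0. Qed.

Lemma weight_list x : exists m, [/\ lowpart (greedy top (ext x)) = mapinc m,
  forall c, weight x c = wt m c, sorted (@prec d n) (unzip2 m) &
  List.Forall (fun p => 0 < p.1) m].
Proof.
have [m E] := lowpart_mapinc (greedy top (ext x)).
have /decompE[l0 ls _] := greedyP top (ext x); have [{}ls _] := sorted_rcons_all ls.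
exists m; split=> //.
- by move=> c; rewrite /weight /W -wt_lowpart E wt_mapinc.
- rewrite -(mono_sorted prec_inc) -unzip2_mapinc -E.
  by apply: subseq_sorted ls; [apply: prec_trans|apply: subseq_map_filter].
have : List.Forall (fun p : R * P' d.+1 n => 0 < p.1) (mapinc m).
  by rewrite -E /lowpart; elim: l0 => //= p r p0 _ IH; case: ifP => // _; constructor.
by move/List.Forall_map.
Qed.

(** The greedy chain starts with the stratum of [x], which is collision-free and carries a positive
    coefficient. *)
Lemma total_pos x : config_space x -> 0 < total x.
Proof.
case/config_strat=> c xc; have D := greedyP top (ext x).
case E : (greedy top (ext x)) D => [|[w e] l] D; have := strat_uniq xc (decomp_strat D) => /=.
  by move=> Ec; have := inc_top c; rewrite Ec prec_irr.
move=> Ec; subst e.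
have := wt_head D; have := @sum_ge_term _ (weight x) c (weight_ge0 x).
by rewrite /total /weight; lra.
Qed.

Lemma weight_lc m x : List.Forall (fun p => 0 < p.1) m ->
  sorted (@prec d n) (unzip2 m) -> (forall a k, x a k = lc m a k) ->
  forall c, weight x c = wt m c.
Proof.
by move=> m0 ms mx c; rewrite /weight (decompW _ (decomp_mapinc m0 ms mx)) wt_mapinc.
Qed.

Lemma Delta_config x : Delta_dn x -> config_space x.
Proof.
case/realizeE=> -[|[w c] m] [ms _ m0 m1 mx]; first by move: m1; rewrite big_nil; lra.
exact: strat_config (decomp_strat (decomp_mapinc m0 ms mx)).
Qed.

Definition center x : pt d n := fun a k => (\sum_c (weight x c * vpt c a k)) / total x.

Definition homotopy (t : R) x : pt d n := fun a k => (1 - t) * x a k + t * center x a k.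

Lemma center_Delta x : config_space x -> Delta_dn (center x).
Proof.
move=> xF; have t0 := total_pos xF; have [m [_ wE ms m0]] := weight_list x.
apply: (@realizeI _ _ _ [seq (p.1 / total x, p.2) | p <- m]).
- by rewrite /unzip2 -map_comp.
- exact: all_predT.
- apply/List.Forall_map; apply: List.Forall_impl m0 => p /= p0.
  by apply: Rle_mult_inv_pos => //; lra.
- rewrite big_map /= -sum_mulr sum_wt1.
  rewrite (eq_bigr (weight x)) -/(total x); first by rewrite Rinv_r; lra.
  by move=> c _; rewrite wE.
move=> a k; rewrite /center /lc big_map /= /Rdiv.
rewrite (eq_bigr (fun p : R * P' d n => p.1 * (vpt p.2 a k * / total x))); last first.
  by move=> p _ /=; ring.
rewrite (sum_wt _ (fun c => vpt c a k * / total x)) sum_mulr.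
by apply: eq_bigr => c _; rewrite wE; lra.
Qed.

Lemma homotopy_config t x : 0 <= t <= 1 -> config_space x -> config_space (homotopy t x).
Proof.
move=> t01 xF; have [->|tN] := Req_dec_T t 1.
  have -> : homotopy 1 x = center x.
    apply: functional_extensionality => a; apply: functional_extensionality => k.
    by rewrite /homotopy; lra.
  exact/Delta_config/center_Delta.
have T0 := total_pos xF; have [c xc] := config_strat xF.
have [m [mE wE _ _]] := weight_list x.
(* For [t < 1] the homotopy only changes the coefficients, by the rule [f] below, and keeps them
   positive. The chain, and with it the stratum at its head, stays the same. *)
have D := greedyP top (ext x); set l := greedy top (ext x) in D mE.
pose f (p : R * P' d.+1 n) :=
  ((1 - t) * p.1 + (if low p.2 then t / total x * p.1 else 0), p.2).
have El : unzip2 (map f l) = unzip2 l by rewrite /unzip2 -map_comp.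
suff D' : decomp top (map f l) (ext (homotopy t x)).
  apply: (@strat_config _ c); have := decomp_strat D'; rewrite El.
  by rewrite (strat_uniq xc (decomp_strat D)).
have /decompE[l0 ls lx] := D; apply/decompE; split; rewrite ?El //.
  apply/List.Forall_map; apply: List.Forall_impl l0 => p /= p0.
  have : 0 <= t / total x by apply: Rle_mult_inv_pos => //; lra.
  by case: ifP => _; nra.
have E2 a k : lc (map f l) a (widen_ord (leqnSn d) k) =
    (1 - t) * lc l a (widen_ord (leqnSn d) k) + t * center x a k.
  have -> : t * center x a k = \sum_(p <- l) ((if low p.2 then t / total x * p.1 else 0) *
      vpt p.2 a (widen_ord (leqnSn d) k)).
    transitivity (t / total x * lc m a k).
      rewrite /center /lc (sum_wt _ (fun c => vpt c a k)).
      rewrite (eq_bigr (fun c => wt m c * vpt c a k)); first by rewrite /Rdiv; lra.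
      by move=> e _; rewrite wE.
    rewrite -lc_mapinc -mE /lc big_filter sum_mull big_mkcond /=.
    by apply: eq_bigr => p _; case: ifP => _; lra.
  rewrite /lc big_map sum_mull -big_split /=; apply: eq_bigr => p _; lra.
apply: flat_top => a b k; rewrite !ext_widen !E2 /homotopy.
suff : x a k - lc l a (widen_ord (leqnSn d) k) = x b k - lc l b (widen_ord (leqnSn d) k) by nra.
have [<- //|N] := eqVneq a b; have kd := ltn_ord k.
have [ab|ab] := before_total top N; have := lx _ _ (widen_ord (leqnSn d) k) ab;
by rewrite mval_top ?(before_neq ab) // !ext_widen => /(_ kd).
Qed.

Lemma homotopy_fixed t x : Delta_dn x -> homotopy t x = x.
Proof.
case/realizeE=> m [ms _ m0 m1 mx]; have wE := weight_lc m0 ms mx.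
have t1 : total x = 1.
  by rewrite -m1 sum_wt1; apply: eq_bigr => c _; rewrite wE.
apply: functional_extensionality => a; apply: functional_extensionality => k.
rewrite /homotopy /center t1 (eq_bigr (fun c => wt m c * vpt c a k)); last first.
  by move=> c _; rewrite wE.
by rewrite -(sum_wt _ (fun c => vpt c a k)) -/(lc m a k) -mx; lra.
Qed.

Lemma config_act (pi : {perm 'I_n}) x : config_space x <-> config_space (act_pt pi x).
Proof.
split=> H j j' N; last first.
  by have := H (pi j) (pi j') (fun E => N (perm_inj E)); rewrite /act_pt !permK.
exact: H (fun E => N (perm_inj E)).
Qed.

Lemma wt_notin (l : seq (R * P' d.+1 n)) (c : P' d.+1 n) : c \notin unzip2 l -> wt l c = 0.
Proof.
elim: l => [|[w e] l IH] /=; first by rewrite /wt big_nil.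
rewrite inE negb_or eq_sym => /andP[/negPf ec /IH E].
by rewrite wt_cons ec E; lra.
Qed.

(** If a low string occurred, the head of the chain would be low too by [low_down], and the head is
    the stratum of the point. *)
Lemma wt_collision (l : seq (R * P' d.+1 n)) x c :
  decomp top l (ext x) -> ~ config_space x -> wt l (inc c) = 0.
Proof.
move=> D xN; apply: wt_notin; apply/negP=> cl.
case: l D cl => [|[w e] l] D //= cl; apply: xN.
have /decompE[_ /= ls _] := D.
have /lowP[e' E] : low e.
  apply: low_down (low_inc c); move: cl; rewrite inE => /predU1P[->|cl]; first exact: preceq_refl.
  have /allP H := order_path_min (@prec_trans _ _) ls.
  by apply/prec_preceq/H; rewrite mem_rcons inE cl orbT.
by subst e; apply: strat_config (decomp_strat D).
Qed.

(** The order of letters in [top] is not invariant, but for a low string only the levels of [top]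
    matter, and these are all [d]. *)
Lemma strat_act (pi : {perm 'I_n}) x c : strat top (ext x) (inc c) ->
  strat top (ext (act_pt pi x)) (inc (act_P pi c)).
Proof.
case=> _ H; split; first exact/prec_preceq/inc_top.
move=> a b; rewrite -[inc (act_P pi c)]/(act_P pi (inc c)) before_act mval_act => ab k.
have N : a != b by apply: contraTneq ab => ->; rewrite /before ltnn.
have [H1 H2] := H _ _ ab k; rewrite mval_top // in H2 *; last exact: before_neq ab.
by rewrite mval_top in H2 *.
Qed.

Lemma bound_pair_act (pi : {perm 'I_n}) c a b k :
  bound_pair top (inc (act_P pi c)) (pi a, pi b, k) = bound_pair top (inc c) (a, b, k).
Proof.
rewrite /bound_pair /= -[inc (act_P pi c)]/(act_P pi (inc c)) before_act mval_act !permK.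
have [ab|//] := boolP (before (inc c) a b); have N := before_neq ab.
by rewrite !mval_top // (inj_eq (@perm_inj _ pi)).
Qed.

Lemma ratio_act (pi : {perm 'I_n}) c x a b k :
  ratio (inc (act_P pi c)) (ext (act_pt pi x)) (pi a, pi b, k) = ratio (inc c) (ext x) (a, b, k).
Proof.
rewrite /ratio /= -[inc (act_P pi c)]/(act_P pi (inc c)) vpt_act /act_pt /ext !permK.
by [].
Qed.

(** As long as no columns collide, the two points are eroded in parallel: the strings correspond,
    and each tight ratio bounds the other. After a collision the chains may diverge, but by
    [wt_collision] no low string is left. *)
Lemma wt_act (pi : {perm 'I_n}) (l l' : seq (R * P' d.+1 n)) x c :
  decomp top l (ext x) -> decomp top l' (ext (act_pt pi x)) ->
  wt l (inc c) = wt l' (inc (act_P pi c)).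
Proof.
elim: l l' x => [|[w e] l IH] l' x D D';
  (have [xF|xN] := classic (config_space x); last by
     have xN' := fun F => xN ((config_act pi x).2 F);
     rewrite (wt_collision _ D xN) (wt_collision _ D' xN')).
  have [e xe] := config_strat xF; have := inc_top e.
  by rewrite (strat_uniq xe (decomp_strat D)) prec_irr.
have [c0 xc] := config_strat xF; have Ee := strat_uniq (decomp_strat D) xc.
rewrite /= in Ee; subst e.
case: l' D' => [|[w' e'] l'] D'; have Ee := strat_uniq (decomp_strat D') (strat_act pi xc).
  by have := inc_top (act_P pi c0); rewrite -Ee prec_irr.
rewrite /= in Ee; subst e'.
have [_ ch /[dup] Dl /decomp_strat /(tight_pair ch) [le [[[a b] k] bt wE]]] := D.
have [_ ch' /[dup] Dl' /decomp_strat /(tight_pair ch') [le' [[[a' b'] k'] bt' wE']]] := D'.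
have Ew : w = w'.
  apply: Rle_antisym.
    rewrite wE' -[a'](permKV pi) -[b'](permKV pi) ratio_act; apply: le.
    by rewrite -(bound_pair_act pi) !permKV.
  by rewrite wE -(ratio_act pi); apply: le'; rewrite bound_pair_act.
rewrite -Ew in Dl' *.
rewrite !wt_cons !(inj_eq inc_inj) (inj_eq (@act_P_inj _ _ pi)); congr (_ + _).
apply: (IH _ (fun a k => x a k - w * vpt c0 a k)).
  apply: decomp_flat Dl; apply: flat_top => a0 b0 k0.
  by rewrite /sub !ext_widen !vpt_inc; lra.
apply: decomp_flat Dl'; apply: flat_top => a0 b0 k0.
by rewrite /sub !ext_widen !vpt_inc vpt_act /act_pt; lra.
Qed.

Lemma weight_act (pi : {perm 'I_n}) x c : weight (act_pt pi x) (act_P pi c) = weight x c.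
Proof. by rewrite /weight /W -(wt_act _ (greedyP _ _) (greedyP _ _)). Qed.

Lemma homotopy_act t (pi : {perm 'I_n}) x :
  homotopy t (act_pt pi x) = act_pt pi (homotopy t x).
Proof.
apply: functional_extensionality => a; apply: functional_extensionality => k.
rewrite /homotopy /center /total; congr (_ + _ * (_ / _)).
  rewrite (reindex_inj (@act_P_inj _ _ pi)) /=; apply: eq_bigr => c _.
  by rewrite weight_act vpt_act.
rewrite (reindex_inj (@act_P_inj _ _ pi)) /=; apply: eq_bigr => c _.
by rewrite weight_act.
Qed.

Lemma homotopy_cont :
  cont_on (fun p q : R * pt d n => Rabs (p.1 - q.1) + dist p.2 q.2) (@dist d n)
    (fun p => 0 <= p.1 <= 1 /\ config_space p.2) (fun p => homotopy p.1 p.2).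
Proof.
apply: cont_onP => -[t x] /= [_ xF] j k.
set dA := (fun p q : R * pt d n => _); set S := (fun p : R * pt d n => _).
have ct : cvat dA S (t, x) (fun p => p.1).
  apply: cvat_dominated => p; rewrite /dA /=.
  have := Rabs_pos (x j k - p.2 j k); have := dist_coord x p.2 j k; lra.
have cx a i : cvat dA S (t, x) (fun p => p.2 a i).
  apply: cvat_dominated => p; rewrite /dA /=.
  have := Rabs_pos (t - p.1); have := dist_coord x p.2 a i; lra.
have cw c : cvat dA S (t, x) (fun p => weight p.2 c).
  apply: (@cvat_W _ _ top _ dA S (t, x) (inc c) (fun p => ext p.2)) => a i; rewrite /ext.
  by case: insub => [i'|]; [apply: cx|apply: cvat_cst].
apply: cvat_add.
  by apply: cvat_mul => //; apply: cvat_sub => //; apply: cvat_cst.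
apply: cvat_mul => //; apply: cvat_div.
- by have := total_pos xF; rewrite /=; lra.
- by apply: cvat_sum => c; apply: cvat_mul => //; apply: cvat_cst.
exact: cvat_sum.
Qed.

Lemma Delta_SDR : equiv_SDR (@Delta_dn d n).
Proof.
split; first exact: Delta_config.
exists homotopy; split; first exact: homotopy_cont.
split; first exact: homotopy_config.
split.
  move=> x _; apply: functional_extensionality => a; apply: functional_extensionality => k.
  by rewrite /homotopy; lra.
split.
  move=> x xF; have -> : homotopy 1 x = center x; last exact: center_Delta.
  apply: functional_extensionality => a; apply: functional_extensionality => k.
  by rewrite /homotopy; lra.
split; first by move=> t x _; apply: homotopy_fixed.
by move=> t x pi _ _; apply: homotopy_act.
Qed.

(** * The simplicial complex and its cell structure *)

Lemma Delta_geometric : geometric_realization d n.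
Proof.
move=> s1 s2 ws1 ws2 /andP[c1 _] /andP[c2 _] z1 z2 p1 p2 _ _ E.
have E11 : unzip1 (zip ws1 s1) = ws1 by apply: unzip1_zip; rewrite z1.
have E12 : unzip2 (zip ws1 s1) = s1 by apply: unzip2_zip; rewrite z1.
have E21 : unzip1 (zip ws2 s2) = ws2 by apply: unzip1_zip; rewrite z2.
have E22 : unzip2 (zip ws2 s2) = s2 by apply: unzip2_zip; rewrite z2.
suff E' : zip ws1 s1 = zip ws2 s2 by split; [rewrite -E12 E' E22|rewrite -E11 E' E21].
apply: lc_uniq; rewrite ?E12 ?E22 //.
- by rewrite -E11 in p1; move/List.Forall_map: p1.
- by rewrite -E21 in p2; move/List.Forall_map: p2.
by move=> a k; rewrite -!bary_lc E.
Qed.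

(** The chain carrying [x] does not depend on the subcomplex in which [x] is found, so membership
    can be read off from any one chain. *)
Lemma realize_uniq (P : pred (P' d n)) x m : realize P x ->
  List.Forall (fun p => 0 < p.1) m -> sorted (@prec d n) (unzip2 m) ->
  (forall a k, x a k = lc m a k) -> all P (unzip2 m).
Proof.
case/realizeE=> m' [ms' mP m0' _ mx'] m0 ms mx.
by rewrite (lc_uniq m0 ms m0' ms') // => a k; rewrite -mx mx'.
Qed.

Lemma sorted_last c s : sorted (@prec d n) (c :: s) ->
  all (fun e => preceq e (last c s)) (c :: s).
Proof.
rewrite lastI => /sorted_rcons_all[_ H]; rewrite all_rcons preceq_refl /=.
by apply: sub_all H => e /prec_preceq.
Qed.

Lemma cell_Delta c x : cell c x -> Delta_dn x.
Proof. by case=> s [? [_ ?]]; exists s; split=> //; split=> //; apply: all_predT. Qed.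

Lemma vpt_cell c : cell c (vpt c).
Proof.
apply: (@realizeI _ _ _ [:: (1, c)]) => //=; rewrite ?preceq_refl //.
- by constructor=> //=; lra.
- by rewrite big_seq1.
by move=> a k; rewrite /lc big_seq1 /=; lra.
Qed.

Lemma cell_sub c c' : (forall x, cell c x -> cell c' x) <-> preceq c c'.
Proof.
split=> [H|cc' x [s [? [sP ?]]]]; last first.
  exists s; split=> //; split=> //; apply: sub_all sP => e /preceq_trans; exact.
(* Test the inclusion on the vertex [vpt c], whose carrier is [c] alone. *)
have : all (fun e => preceq e c') (unzip2 [:: (1, c)]).
  apply: (realize_uniq (H _ (vpt_cell c))) => //.
    by constructor=> //=; lra.
  by move=> a k; rewrite /lc big_seq1 /=; lra.
by rewrite /= andbT.
Qed.

Lemma Delta_regular_CW : regular_CW d n.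
Proof.
split; first by move=> c; have [h [g H]] := cell_homeo c; exists h, g.
(* The cell with [x] in its interior belongs to the last string of the carrying chain; any other
   cell containing [x] has a strictly larger index, so [x] is on its boundary. *)
have D x : Delta_dn x -> exists c, [/\ cell c x, ~ bdry c x &
    forall e, cell e x -> ~ bdry e x -> e = c].
  case/realizeE=> -[|[w c] m] [ms _ m0 m1 mx]; first by move: m1; rewrite big_nil; lra.
  have lst := sorted_last ms; set cm := last c (unzip2 m) in lst.
  have m0' : List.Forall (fun p => 0 <= p.1) ((w, c) :: m).
    by apply: List.Forall_impl m0 => p; lra.
  exists cm; split.
  - exact: (realizeI ms lst m0' m1 mx).
  - move=> bx; have /allP /(_ cm (mem_last _ _)) := realize_uniq bx m0 ms mx.
    by rewrite prec_irr.
  move=> e ex eN; have me := realize_uniq ex m0 ms mx; apply/eqP/negPn/negP=> ne.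
  apply: eN; apply: (realizeI ms _ m0' m1 mx).
  have ce : prec cm e.
    by rewrite /prec (allP me) 1?eq_sym ?ne //; apply: mem_last.
  by apply: sub_all lst => f /preceq_prec_trans; apply.
split; first by move=> x; split=> [/D[c [? _ _]]|[c /cell_Delta]] //; exists c.
split; first by move=> x /D[c [? ? _]]; exists c.
move=> x c c' cx cN c'x c'N; have [e [_ _ H]] := D x (cell_Delta cx).
by rewrite (H c) // (H c').
Qed.

End AddedLevel.

(** * Numbers of cells *)

Section Counting.
Variables (d n : nat).
Local Notation fn := {ffun 'I_n.-1 -> 'I_d.+1}.

Lemma card_strings (Q : pred fn) :
  #|[pred c : P' d.+1 n | Q c.2]| = (n`! * #|[pred f | Q f]|)%N.
Proof.
rewrite -(card_Sn n) -cardX; apply: eq_card => -[s f].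
by rewrite !inE.
Qed.

Lemma dimP_le (c : P' d.+1 n) : (dimP c <= d * n.-1)%N.
Proof.
rewrite mulnC -[X in (X * _)%N]card_ord -sum_nat_const.
by apply: leq_sum => j _; rewrite -ltnS.
Qed.

Definition defect (f : fn) := (\sum_j (d - f j))%N.

Lemma defectE (f : fn) : (\sum_j f j + defect f = d * n.-1)%N.
Proof.
rewrite -big_split /= (eq_bigr (fun=> d)) ?sum_nat_const ?card_ord 1?mulnC // => j _.
by have := ltn_ord (f j); lia.
Qed.

Lemma card_dim0 : #|[pred c : P' d.+1 n | dimP c == 0%N]| = n`!.
Proof.
rewrite (card_strings (fun f => \sum_j f j == 0)%N) (eq_card1 (x := [ffun=> ord0])) ?muln1 //.
move=> f; rewrite !inE sum_nat_eq0; apply/forallP/eqP => [H|-> j].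
  by apply/ffunP=> j; rewrite ffunE; apply: val_inj; have /eqP := H j.
by rewrite ffunE.
Qed.

Lemma defect0 (f : fn) : (defect f == 0%N) = (f == [ffun=> ord_max]).
Proof.
rewrite /defect sum_nat_eq0; apply/forallP/eqP => [H|-> j]; last first.
  by rewrite ffunE /= subnn.
apply/ffunP=> j; rewrite ffunE; apply: val_inj => /=.
by have := H j; have := ltn_ord (f j); rewrite /=; lia.
Qed.

Lemma card_top : #|[pred f : fn | f == [ffun=> ord_max]]| = 1%N.
Proof. by apply: (eq_card1 (x := [ffun=> ord_max])) => f; rewrite !inE. Qed.

Lemma card_dim_max : #|[pred c : P' d.+1 n | dimP c == (d * n.-1)%N]| = n`!.
Proof.
rewrite (card_strings (fun f => \sum_j f j == d * n.-1)%N) -[RHS]muln1 -card_top.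
congr (_ * _)%N; apply: eq_card => f; rewrite !inE -defect0.
by have := defectE f; lia.
Qed.

(** Raising all levels to the maximum keeps the order of letters and goes up. Conversely, maximal
    levels leave no room for the strict increase that a reversal needs. *)
Lemma card_maximal :
  #|[pred c : P' d.+1 n | [forall c', preceq c c' ==> (c' == c)]]| = n`!.
Proof.
transitivity (#|[pred c : P' d.+1 n | c.2 == [ffun=> ord_max]]|); last first.
  by rewrite (card_strings (fun f => f == [ffun=> ord_max])) card_top muln1.
apply: eq_card => c; rewrite !inE.
pose cmax : P' d.+1 n := (c.1, [ffun=> ord_max]).
have mvalmax a b : (c.2 == [ffun=> ord_max]) -> before c a b -> mval c a b = d.
  by move=> /eqP E /mval_attained[j _ <-]; rewrite E ffunE.
apply/forallP/idP => [/(_ cmax) H|E c'].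
  have le : preceq c cmax.
    apply/preceqP=> a b ab; left; split=> //.
    have [j _ <-] := mval_attained ab; rewrite /= ffunE /= -ltnS.
    exact: (@mval_lt _ _ c a b ab).
  by move: H; rewrite le => /eqP <- /=.
apply/implyP=> /preceqP cc'; apply/eqP.
have H a b : before c' a b -> before c a b /\ mval c' a b = mval c a b.
  move=> ab; have := mval_lt ab; have := cc' _ _ ab.
  case=> -[cab]; first by rewrite (mvalmax _ _ E cab); split=> //; lia.
  by rewrite mval_sym (mvalmax _ _ E cab); lia.
by apply: stringP => a b /H[].
Qed.

End Counting.

Lemma card_codim1 d n : (1 < n)%N ->
  #|[pred c : P' d.+2 n | dimP c == (d.+1 * n.-1).-1]| = ((n.-1) * n`!)%N.
Proof.
move=> n1; rewrite (card_strings (fun f => \sum_j f j == (d.+1 * n.-1).-1)%N) mulnC.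
congr (_ * _)%N; rewrite -[RHS]card_ord.
(* The maximal level is [d.+1]; defect 1 means that exactly one step, here [j], has level [d]
   instead. *)
pose g (j : 'I_n.-1) : {ffun 'I_n.-1 -> 'I_d.+2} :=
  [ffun i => if i == j then inord d else ord_max].
have g_inj : injective g.
  move=> j j' /ffunP/(_ j); rewrite !ffunE eqxx; case: eqP => // _.
  by move/(congr1 val) => /=; rewrite inordK; lia.
rewrite -(card_codom g_inj); apply: eq_card => f; rewrite !inE.
have -> : (\sum_j f j == (d.+1 * n.-1).-1)%N = (defect f == 1)%N.
  (* Positivity prevents the predecessor from being truncated at 0. *)
  have := defectE f; have : (0 < d.+1 * n.-1)%N by rewrite muln_gt0; lia.
  by move: (defect f) (d.+1 * n.-1)%N (\sum_j f j)%N => D N s; lia.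
apply/sum_nat_eq1/codomP => [[j [_ Fj H]]|[j ->]]; exists j.
  apply/ffunP=> i; rewrite ffunE; apply: val_inj; case: eqVneq => [->|ij] /=.
    by rewrite inordK //; have := ltn_ord (f j); lia.
  by have /= := H i ij isT; have /= := ltn_ord (f i); rewrite ltnS; lia.
split=> //; first by rewrite ffunE eqxx inordK //; lia.
by move=> i ij _; rewrite ffunE (negPf ij) /= subnn.
Qed.

Theorem theorem3p3 (d n : nat) (hd : (1 <= d)%N) (hn : (2 <= n)%N) :
  (* (4) realization, contained in F, equivariant SDR *)
  geometric_realization d n /\
  equiv_SDR (@Delta_dn d n) /\
  (* X(d,n) = Delta_dn(d,n) with cells indexed by P'(d,n), regular CW, dims (2) *)
  regular_CW d n /\
  (* (3) *)
  (forall c c' : P' d n, (forall x, cell c x -> cell c' x) <-> preceq c c') /\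
  (* dimension (d-1)(n-1), counts of vertices / maximal cells / codim-1 cells *)
  (forall c : P' d n, (dimP c <= (d - 1) * (n - 1))%N) /\
  #|[pred c : P' d n | dimP c == 0%N]| = n`! /\
  #|[pred c : P' d n | [forall c' : P' d n, preceq c c' ==> (c' == c)]]| = n`! /\
  #|[pred c : P' d n | dimP c == ((d - 1) * (n - 1))%N]| = n`! /\
  ((2 <= d)%N -> #|[pred c : P' d n | dimP c == ((d - 1) * (n - 1)).-1]| = ((n - 1) * n`!)%N) /\
  (* (5) equivariance *)
  (forall (pi : {perm 'I_n}) (c c' : P' d n),
     vpt (act_P pi c) = act_pt pi (vpt c) /\
     preceq (act_P pi c) (act_P pi c') = preceq c c' /\
     (forall x, cell c x -> cell (act_P pi c) (act_pt pi x))).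
Proof.
case: d hd => // d _; rewrite !subn1 /=.
split; first exact: Delta_geometric.
split; first exact: Delta_SDR.
split; first exact: Delta_regular_CW.
split; first exact: cell_sub.
split; first exact: dimP_le.
split; first exact: card_dim0.
split; first exact: card_maximal.
split; first exact: card_dim_max.
split; first by case: d => // d _; apply: card_codim1.
move=> pi c c'; split; first exact: vpt_act.
by split; [apply: preceq_act|move=> x; apply: cell_act].
Qed.
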